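(* Let $\mathbb{K}$ be a commutative field, $n$ a positive integer, and $f : \mathfrak{sl}_n(\mathbb{K}) \to \mathfrak{sl}_n(\mathbb{K})$ a linear automorphism (bijective linear map) such that $f(\mathfrak{sl}_n(\mathbb{K}) \cap \operatorname{GL}_n(\mathbb{K})) \subset \operatorname{GL}_n(\mathbb{K})$. Then there exist $P \in \operatorname{GL}_n(\mathbb{K})$ and a non-zero scalar $\lambda\in\mathbb{K}$ such that either $f(M)=\lambda\,PMP^{-1}$ for all $M \in \mathfrak{sl}_n(\mathbb{K})$, or $f(M)=\lambda\,PM^TP^{-1}$ for all $M \in \mathfrak{sl}_n(\mathbb{K})$.
   Context: $\mathfrak{sl}_n(\mathbb{K})$ is the vector space of $n\times n$ matrices over $\mathbb{K}$ with trace zero. *)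

(* Defs.v *)
From HB Require Import structures.
From mathcomp Require Import all_boot all_order all_algebra.

Set Implicit Arguments.
Unset Strict Implicit.
Unset Printing Implicit Defensive.

Import GRing.Theory.
Local Open Scope ring_scope.

Definition sl (K : fieldType) (n : nat) : {vspace 'M[K]_n} :=
  lker (linfun (mxtrace : 'M[K]_n -> K^o)).

(* [linfun g] agrees with [g] only when [g] is linear, so this membership
   criterion is not definitional. *)
Lemma mem_sl (K : fieldType) (n : nat) (M : 'M[K]_n) :
  (M \in sl K n) = (\tr M == 0).
Proof. by rewrite memv_ker lfunE. Qed.

(* Main.v *)
Require Import Defs.
From HB Require Import structures.
From mathcomp Require Import all_boot all_order all_algebra.
From mathcomp Require Import perm zify ring.
From Stdlib Require Import Classical_Prop.

Set Implicit Arguments.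
Unset Strict Implicit.
Unset Printing Implicit Defensive.

Import GRing.Theory.
Local Open Scope ring_scope.

(** A linear automorphism of the trace-zero matrices extends to a linear
    automorphism [F] of all matrices that preserves the trace ([extend_sl]). Let [G]
    be the adjoint of [F] for the entrywise pairing; it is bijective and fixes the
    identity. For a non-zero column [y], let [T_y] be spanned by the identity and the
    values of [G] on the matrices [y *m p]. A matrix [v] annihilated by [T_y] has
    trace zero and satisfies [y^T *m F v = 0], so [F v] is singular, and hence [v] is
    singular too ([good_line_space]). Thus [T_y] has dimension at most [n + 1],
    contains a regular matrix, and annihilates only singular ones.

    The heart of the proof is that such a space contains all matrices with some
    fixed image line, or all matrices with some fixed kernel hyperplane. In order at
    least four this holds over every field ([good_space_contains]). Order the
    positions of a matrix by an injective weight [a i + b j]. If a permutation avoids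
    the leading positions of the elements of [T], then the dual echelon form provides
    one annihilated matrix for each position of the permutation, and some sum of
    these matrices is regular ([transversal_unitmx]). So no permutation avoids the
    leading positions, and there are at most [n + 1] of them: by a counting argument
    in the style of Koenig ([avoiding_perm]) they fill a row or a column and at most
    one of them lies elsewhere ([leads_fill_line]). As this holds for all bases and
    all such orders, it leaves little freedom: a matrix of rank one is found in [T],
    and then a whole space of them.

    In order three the same conclusion holds over fields with more than two elements,
    by polarization of the determinant on the annihilator of [T]
    ([singular_space_kernel]). It fails over the field with two elements, where every
    triangular matrix of trace zero and order three is singular. In that case the
    theorem is settled by a search, up to conjugation, through the partial linear maps
    that preserve regularity ([sl3_two_elements]).

    In all other cases with [n >= 3], each [T_y] therefore consists, modulo scalar
    matrices, of the matrices with a given image line, or of those with a given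
    kernel hyperplane. Since a
    non-zero scalar matrix is not a sum of two matrices of rank one, the same
    alternative holds for all [y], and a transposition reduces the second one to the
    first. Comparing [G] on the lines of [y], [y'] and [y + y'] then shows that
    [G B = c *: (invmx L *m B *m L)] modulo scalar matrices ([adjoint_form]), which is
    the conclusion for [F] by duality.

    In order two the singular trace-zero matrices are the nilpotent ones. The inverse
    of [F] can be conjugated so as to fix one elementary nilpotent matrix and to
    rescale the other, and the determinants of the images of the other nilpotent
    matrices determine the remaining coefficients ([sl_preserver_standard2]). *)

(** [F] is a linear automorphism of the whole matrix space that preserves the
    trace and restricts to a weak preserver of invertibility on the matrices of
    trace zero. *)
Definition sl_preserver (K : fieldType) (n : nat)
    (F : {linear 'M[K]_n -> 'M[K]_n}) : Prop :=
  [/\ forall M, \tr (F M) = \tr M, injective F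
    & forall M, \tr M = 0 -> M \in unitmx -> F M \in unitmx].

(** On trace-zero matrices, [F] is a non-zero multiple of a conjugation, possibly
    composed with the transposition. *)
Definition standard_on_sl (K : fieldType) (n : nat)
    (F : 'M[K]_n -> 'M[K]_n) : Prop :=
  exists (P : 'M[K]_n) (lambda : K),
    [/\ P \in unitmx, lambda != 0 &
      (forall M, \tr M = 0 -> F M = lambda *: (P *m M *m invmx P)) \/
      (forall M, \tr M = 0 -> F M = lambda *: (P *m M^T *m invmx P))].

(** * Small matrices *)

(** The three indices of a matrix of order three. *)
Definition i30 : 'I_3 := @Ordinal 3 0 isT.
Definition i31 : 'I_3 := @Ordinal 3 1 isT.
Definition i32 : 'I_3 := @Ordinal 3 2 isT.

Lemma ord3P (i : 'I_3) : [\/ i = i30, i = i31 | i = i32].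
Proof.
case: i => [[|[|[|//]]] Hi];
  [apply: Or31 | apply: Or32 | apply: Or33]; exact: val_inj.
Qed.

Lemma sum3E (V : nmodType) (F : 'I_3 -> V) :
  \sum_i F i = F i30 + F i31 + F i32.
Proof.
rewrite !big_ord_recl big_ord0 addr0 addrA.
by congr (F _ + F _ + F _); apply: val_inj.
Qed.

Lemma mx3P (T : Type) (A B : 'M[T]_3) :
  [/\ A i30 i30 = B i30 i30, A i30 i31 = B i30 i31 & A i30 i32 = B i30 i32] ->
  [/\ A i31 i30 = B i31 i30, A i31 i31 = B i31 i31 & A i31 i32 = B i31 i32] ->
  [/\ A i32 i30 = B i32 i30, A i32 i31 = B i32 i31 & A i32 i32 = B i32 i32] ->
  A = B.
Proof.
move=> [? ? ?] [? ? ?] [? ? ?]; apply/matrixP => i j.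
by case: (ord3P i) => ->; case: (ord3P j) => ->.
Qed.

Lemma det2E (R : comPzRingType) (A : 'M[R]_2) :
  \det A = A ord0 ord0 * A ord_max ord_max - A ord0 ord_max * A ord_max ord0.
Proof.
have lE (i : 'I_1) : lift ord0 i = ord_max :> 'I_2.
  by apply: val_inj; case: i => [[|//]].
have lE' (i : 'I_1) : lift ord_max i = ord0 :> 'I_2.
  by apply: val_inj; case: i => [[|//]].
rewrite (expand_det_row A ord0) big_ord_recl big_ord1 /cofactor lE.
rewrite !det_mx11 !mxE lE lE' /= addn0 addn1 expr0 expr1; ring.
Qed.

Lemma det3E (R : comPzRingType) (A : 'M[R]_3) :
  \det A = A i30 i30 * (A i31 i31 * A i32 i32 - A i31 i32 * A i32 i31)
         - A i30 i31 * (A i31 i30 * A i32 i32 - A i31 i32 * A i32 i30)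
         + A i30 i32 * (A i31 i30 * A i32 i31 - A i31 i31 * A i32 i30).
Proof.
rewrite (expand_det_row A i30) sum3E /cofactor !det2E !mxE /=.
have E (i j k : 'I_3) (a : 'I_2) : nat_of_ord (lift i a) = k -> lift i a = k.
  by move=> h; apply: val_inj.
rewrite (E i30 i30 i31 ord0) // (E i30 i30 i32 ord_max) //.
rewrite (E i31 i30 i30 ord0) // (E i31 i30 i32 ord_max) //.
rewrite (E i32 i30 i30 ord0) // (E i32 i30 i31 ord_max) //.
by rewrite /= addn0 addn1 addn2 expr0 expr1 sqrrN expr1n; ring.
Qed.

(** * Matrices of order three over the field with two elements *)

(** A matrix of order three with entries in the field with two elements, given by
    its entries row by row. *)
Inductive bmx :=
  BMx of bool & bool & bool & bool & bool & bool & bool & bool & bool.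

Definition bmx0 :=
  BMx false false false false false false false false false.

(** Sums and products of entries are taken modulo two. *)
Definition bmx_add (u v : bmx) :=
  let: BMx a b c d e f g h i := u in
  let: BMx a' b' c' d' e' f' g' h' i' := v in
  BMx (a (+) a') (b (+) b') (c (+) c') (d (+) d') (e (+) e') (f (+) f')
      (g (+) g') (h (+) h') (i (+) i').

Definition bmx_mul (u v : bmx) :=
  let: BMx a b c d e f g h i := u in
  let: BMx a' b' c' d' e' f' g' h' i' := v in
  BMx (a && a' (+) b && d' (+) c && g') (a && b' (+) b && e' (+) c && h')
      (a && c' (+) b && f' (+) c && i')
      (d && a' (+) e && d' (+) f && g') (d && b' (+) e && e' (+) f && h')
      (d && c' (+) e && f' (+) f && i')
      (g && a' (+) h && d' (+) i && g') (g && b' (+) h && e' (+) i && h')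
      (g && c' (+) h && f' (+) i && i').

Definition bmx_tr (u : bmx) :=
  let: BMx a b c d e f g h i := u in BMx a d g b e h c f i.

Definition bmx_det (u : bmx) :=
  let: BMx a b c d e f g h i := u in
  a && (e && i (+) f && h) (+) b && (d && i (+) f && g)
  (+) c && (d && h (+) e && g).

Definition bmx_trace (u : bmx) :=
  let: BMx a b c d e f g h i := u in a (+) e (+) i.

Definition bmx_eq (u v : bmx) :=
  let: BMx a b c d e f g h i := u in
  let: BMx a' b' c' d' e' f' g' h' i' := v in
  [&& a == a', b == b', c == c', d == d', e == e', f == f', g == g', h == h'
    & i == i'].

Lemma bmx_eqP u v : reflect (u = v) (bmx_eq u v).
Proof.
case: u => a b c d e f g h i; case: v => a' b' c' d' e' f' g' h' i'.
apply: (iffP idP) => [|[]]; last by do 9 move->; rewrite /= !eqxx.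
by rewrite /=; do 8 case/andP => /eqP->; move/eqP->.
Qed.

HB.instance Definition _ := hasDecEq.Build bmx bmx_eqP.

(** The list of all 512 matrices. *)
Definition all_bmx : seq bmx := Eval vm_compute in
  let bools := [:: false; true] in
  let rows := [seq (a, bc) | a <- bools, bc <- [seq (b, c) | b <- bools, c <- bools]] in
  [seq BMx p.1.1 p.1.2.1 p.1.2.2 p.2.1.1 p.2.1.2.1 p.2.1.2.2
           p.2.2.1 p.2.2.2.1 p.2.2.2.2
  | p <- [seq (x, yz) | x <- rows, yz <- [seq (y, z) | y <- rows, z <- rows]]].

Lemma mem_all_bmx u : u \in all_bmx.
Proof. by case: u => [] [] [] [] [] [] [] [] [] []. Qed.

(** The list of all matrices of trace zero. *)
Definition traceless_bmx :=
  Eval vm_compute in [seq u <- all_bmx | ~~ bmx_trace u].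

Lemma mem_traceless u : ~~ bmx_trace u -> u \in traceless_bmx.
Proof.
have -> : traceless_bmx = [seq u <- all_bmx | ~~ bmx_trace u] by vm_compute.
by rewrite mem_filter mem_all_bmx => ->.
Qed.

(** The list of all invertible matrices. *)
Definition regular_bmx :=
  Eval vm_compute in [seq u <- all_bmx | bmx_det u].

Lemma mem_regular u : u \in regular_bmx -> bmx_det u.
Proof.
have -> : regular_bmx = [seq u <- all_bmx | bmx_det u] by vm_compute.
by rewrite mem_filter => /andP[].
Qed.

(* Conditionals replace the boolean connectives so that evaluation stops at the
   first witness under every reduction strategy. *)
Fixpoint every T (a : T -> bool) (s : seq T) : bool :=
  if s is x :: s' then if a x then every a s' else false else true.

Fixpoint some T (a : T -> bool) (s : seq T) : bool :=
  if s is x :: s' then if a x then true else some a s' else false.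

Lemma everyE T (a : T -> bool) s : every a s = all a s.
Proof. by elim: s => //= x s ->; case: (a x). Qed.

Lemma someE T (a : T -> bool) s : some a s = has a s.
Proof. by elim: s => //= x s ->; case: (a x). Qed.

(** A list of pairs [(u, v)] stands for the graph of a partial map [u |-> v]; it is
    standard when the map is a conjugation, possibly after transposition. The
    conjugation by [P] is written as a commutation relation, without inverse. *)
Definition standard_table (s : seq (bmx * bmx)) : bool :=
  some (fun P =>
    if every (fun p => bmx_eq (bmx_mul p.2 P) (bmx_mul P p.1)) s then true
    else every (fun p => bmx_eq (bmx_mul p.2 P) (bmx_mul P (bmx_tr p.1))) s)
  regular_bmx.

(** Extending the additive table [s] by [b |-> v] keeps it injective, and no new
    entry sends a regular matrix to a singular one. *)
Definition extends (b : bmx) (s : seq (bmx * bmx)) (v : bmx) : bool :=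
  every (fun p =>
    if bmx_eq p.2 v then false
    else if bmx_det (bmx_add p.1 b) then bmx_det (bmx_add p.2 v) else true) s.

(** [search bs s] decides whether every extension of the additive table [s] to the
    span of its domain and [bs] that is injective, and sends regular matrices to
    regular matrices, is standard. *)
Fixpoint search (bs : seq bmx) (s : seq (bmx * bmx)) : bool :=
  if bs is b :: bs' then
    every (fun v =>
      if extends b s v
      then search bs' (s ++ [seq (bmx_add p.1 b, bmx_add p.2 v) | p <- s])
      else true) traceless_bmx
  else standard_table s.

Lemma search_consE b bs s :
  search (b :: bs) s = all (fun v =>
      if extends b s v
      then search bs (s ++ [seq (bmx_add p.1 b, bmx_add p.2 v) | p <- s])
      else true) traceless_bmx.
Proof. by rewrite -everyE. Qed.

(** All sums of an element of [s] and a subset of [bs]. *)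
Fixpoint span_bmx (bs s : seq bmx) : seq bmx :=
  if bs is b :: bs' then span_bmx bs' (s ++ [seq bmx_add u b | u <- s]) else s.

(** A basis of the trace-zero matrices whose initial segments span as many regular
    matrices as possible, which keeps the search small; its first vector is listed
    separately. *)
Definition sl3_vec := BMx false true true true true false false false true.

Definition sl3_basis :=
  [:: BMx false false true true true true true false true;
      BMx true false false true false true false true true;
      BMx true true false true true true true false false;
      BMx true true false false true false true true false;
      BMx true true false false false false true false true;
      BMx false false false false false false true false false;
      BMx false false false false true false false false true].

(** The companion matrices of the two cubics [X^3 + X + 1] and [X^3 + 1], which are
    the characteristic polynomials of the regular matrices of trace zero. *)
Definition comp1 := BMx false false true true false true false true false.
Definition comp2 := BMx false false true true false false false true false.

Lemma traceless_regular_conj u : ~~ bmx_trace u -> bmx_det u ->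
  exists2 P, bmx_det P &
    bmx_mul P u = bmx_mul comp1 P \/ bmx_mul P u = bmx_mul comp2 P.
Proof.
move=> /mem_traceless tu du.
have: every (fun v => if bmx_det v then
    some (fun P => if bmx_eq (bmx_mul P v) (bmx_mul comp1 P) then true
                   else bmx_eq (bmx_mul P v) (bmx_mul comp2 P)) regular_bmx
  else true) traceless_bmx by vm_compute.
rewrite everyE => /allP/(_ _ tu); rewrite du someE.
case/hasP => P /mem_regular dP; case: bmx_eqP => [e _|_ /bmx_eqP e]; exists P => //.
  by left.
by right.
Qed.

Lemma search_comp1 : search sl3_basis [:: (bmx0, bmx0); (sl3_vec, comp1)].
Proof. by vm_compute. Qed.

Lemma search_comp2 : search sl3_basis [:: (bmx0, bmx0); (sl3_vec, comp2)].
Proof. by vm_compute. Qed.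

Lemma span_sl3 u : ~~ bmx_trace u -> u \in span_bmx sl3_basis [:: bmx0; sl3_vec].
Proof.
have: every (fun u => some (bmx_eq u) (span_bmx sl3_basis [:: bmx0; sl3_vec]))
  traceless_bmx by vm_compute.
rewrite everyE => /allP all_u /mem_traceless/all_u.
by rewrite someE => /hasP[v v_in /bmx_eqP->].
Qed.

Lemma span_sl3_uniq : uniq (span_bmx sl3_basis [:: bmx0; sl3_vec]).
Proof. by vm_compute. Qed.

Lemma bmx_traceD u v :
  bmx_trace (bmx_add u v) = bmx_trace u (+) bmx_trace v.
Proof.
case: u v => a b c d e f g h i [a' b' c' d' e' f' g' h' i'] /=.
by case: a a' e e' i i' => [] [] [] [] [] [].
Qed.

(** A map that satisfies the constraints of [search] follows one of its branches,
    so that its own table is among those found standard. *)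
Lemma search_sound (F : bmx -> bmx) bs s :
  (forall u v, F (bmx_add u v) = bmx_add (F u) (F v)) ->
  (forall u, ~~ bmx_trace u -> ~~ bmx_trace (F u)) ->
  injective F ->
  (forall u, ~~ bmx_trace u -> bmx_det u -> bmx_det (F u)) ->
  all (fun b => ~~ bmx_trace b) bs -> all (fun u => ~~ bmx_trace u) s ->
  uniq (span_bmx bs s) -> bmx0 \in s ->
  search bs [seq (u, F u) | u <- s] ->
  standard_table [seq (u, F u) | u <- span_bmx bs s].
Proof.
move=> FD Ftr Finj Fdet; elim: bs s => [|b bs IHbs] s // /andP[trb trbs] trs Us s0.
have trD u v : ~~ bmx_trace u -> ~~ bmx_trace v -> ~~ bmx_trace (bmx_add u v).
  by rewrite bmx_traceD => /negbTE-> /negbTE->.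
rewrite search_consE => /allP/(_ _ (mem_traceless (Ftr _ trb))).
have Us' : uniq (s ++ [seq bmx_add u b | u <- s]).
  elim: (bs) (s ++ _) (Us : uniq (span_bmx bs _)) => //= c bs' IH t /IH; rewrite cat_uniq; by case/and3P.
have bs' : b \notin s.
  move: Us'; rewrite cat_uniq => /and3P[_ /hasPn/(_ b) + _]; apply.
  by apply/mapP; exists bmx0 => //; case: (b).
have /allP trs' := trs.
rewrite ifT; last first.
  rewrite /extends everyE all_map; apply/allP => u us /=.
  have tru := trs' _ us.
  rewrite ifF; last by apply/negbTE/bmx_eqP => /Finj eq_ub; rewrite -eq_ub us in bs'.
  by rewrite -FD //; case: ifP => // /Fdet -> //; exact: trD.
rewrite -map_comp => sr; apply: IHbs => //.
- rewrite all_cat trs all_map; apply/allP => u us /=.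
  by apply: trD => //; exact: trs'.
- by rewrite mem_cat s0.
rewrite map_cat -map_comp; congr (is_true (search _ (_ ++ _))): sr.
by apply/eq_in_map => u us /=; rewrite FD.
Qed.

(** The matrix over [K] with the entries of [u]. *)
Definition mx_of_bmx (K : fieldType) (u : bmx) : 'M[K]_3 :=
  let: BMx a b c d e f g h i := u in
  \matrix_(k, l) (nth false [:: a; b; c; d; e; f; g; h; i] (3 * k + l))%:R.

(** An inverse of [mx_of_bmx] when [0] and [1] are the only elements of [K]. *)
Definition bmx_of_mx (K : fieldType) (M : 'M[K]_3) : bmx :=
  BMx (M i30 i30 != 0) (M i30 i31 != 0) (M i30 i32 != 0)
      (M i31 i30 != 0) (M i31 i31 != 0) (M i31 i32 != 0)
      (M i32 i30 != 0) (M i32 i31 != 0) (M i32 i32 != 0).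

Section TwoElements.

Variable K : fieldType.
Hypothesis K01 : forall a : K, a = 0 \/ a = 1.

Let addKK (a : K) : a + a = 0.
Proof.
case: (K01 a) => ->; first by rewrite addr0.
case: (K01 (1 + 1 : K)) => // /(canRL (addrK 1)); rewrite subrr => /eqP.
by rewrite oner_eq0.
Qed.

Let oppK (a : K) : - a = a.
Proof. by apply/eqP; rewrite eq_sym -subr_eq0 opprK addKK. Qed.

Let addbK (a b : bool) : (a (+) b)%:R = a%:R + b%:R :> K.
Proof. by case: a; case: b; rewrite ?addKK ?addr0 ?add0r. Qed.

Let andbK (a b : bool) : (a && b)%:R = a%:R * b%:R :> K.
Proof. by case: a; case: b; rewrite ?mulr1 ?mulr0. Qed.

Let natbK (a : bool) : (a%:R != 0 :> K) = a.
Proof. by case: a; rewrite ?oner_eq0 ?eqxx. Qed.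

Notation toM := (mx_of_bmx K).
Notation ofM := (@bmx_of_mx K).

Lemma bmx_of_mxK : cancel ofM toM.
Proof.
move=> M; have e a : ((a != 0 :> K) : bool)%:R = a.
  by case: (K01 a) => ->; rewrite ?eqxx ?oner_eq0.
by apply: mx3P; split; rewrite mxE /= ?e.
Qed.

Lemma mx_of_bmxK : cancel toM ofM.
Proof.
by case=> a b c d e f g h i; rewrite /bmx_of_mx !mxE /= !natbK.
Qed.

Lemma mx_of_bmxD u v : toM (bmx_add u v) = toM u + toM v.
Proof.
case: u => a b c d e f g h i; case: v => a' b' c' d' e' f' g' h' i'.
by apply: mx3P; split; rewrite !mxE /= addbK.
Qed.

Lemma mx_of_bmxM u v : toM (bmx_mul u v) = toM u *m toM v.
Proof.
case: u => a b c d e f g h i; case: v => a' b' c' d' e' f' g' h' i'.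
by apply: mx3P; split; rewrite !mxE sum3E !mxE /= !(addbK, andbK) ?addrA.
Qed.

Lemma mx_of_bmx_tr u : toM (bmx_tr u) = (toM u)^T.
Proof.
by case: u => a b c d e f g h i; apply: mx3P; split; rewrite !mxE.
Qed.

Lemma mxtrace_bmx u : (\tr (toM u) == 0) = ~~ bmx_trace u.
Proof.
case: u => a b c d e f g h i.
by rewrite /mxtrace sum3E !mxE /= -!addbK -[_ == 0]negbK natbK.
Qed.

Lemma unitmx_bmx u : (toM u \in unitmx) = bmx_det u.
Proof.
rewrite unitmxE unitfE det3E; case: u => a b c d e f g h i.
rewrite !mxE /= !oppK -!andbK -!addbK -!andbK -!addbK natbK.
by rewrite -!addbA.
Qed.

(** The images of [sl3_vec] need to be searched only up to conjugation, hence the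
    replacement of [F] by its conjugate [G]. *)
Lemma sl3_two_elements (F : {linear 'M[K]_3 -> 'M[K]_3}) :
  sl_preserver F -> standard_on_sl F.
Proof.
move=> [Ftr Finj Funit].
have tr_vec : ~~ bmx_trace sl3_vec by [].
set v1 := ofM (F (toM sl3_vec)).
have tr_v1 : ~~ bmx_trace v1.
  by rewrite -mxtrace_bmx bmx_of_mxK Ftr mxtrace_bmx.
have det_v1 : bmx_det v1.
  rewrite -unitmx_bmx bmx_of_mxK Funit ?unitmx_bmx //.
  by apply/eqP; rewrite mxtrace_bmx.
have [P0 dP0 eP0] := traceless_regular_conj tr_v1 det_v1.
set P := toM P0; have uP : P \in unitmx by rewrite unitmx_bmx.
pose G u := ofM (P *m F (toM u) *m invmx P).
have GE u : toM (G u) = P *m F (toM u) *m invmx P by rewrite bmx_of_mxK.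
have tr_conj M : \tr (P *m M *m invmx P) = \tr M.
  by rewrite mxtrace_mulC mulmxA mulVmx // mul1mx.
have GD u v : G (bmx_add u v) = bmx_add (G u) (G v).
  apply: (can_inj mx_of_bmxK).
  by rewrite mx_of_bmxD !GE mx_of_bmxD linearD mulmxDr mulmxDl.
have Gtr u : ~~ bmx_trace u -> ~~ bmx_trace (G u).
  by rewrite -!mxtrace_bmx GE tr_conj Ftr.
have Ginj : injective G.
  move=> u v /(congr1 (fun x => toM x)); rewrite !GE.
  move=> /(congr1 (mulmx^~ P)); rewrite !mulmxKV //.
  by move=> /(congr1 (mulmx (invmx P))); rewrite !mulKmx // => /Finj/(can_inj mx_of_bmxK).
have Gdet u : ~~ bmx_trace u -> bmx_det u -> bmx_det (G u).
  rewrite -mxtrace_bmx -!unitmx_bmx GE => /eqP tru uu.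
  by rewrite !unitmx_mul uP unitmx_inv uP Funit.
have G0 : G bmx0 = bmx0.
  apply: (can_inj mx_of_bmxK); rewrite GE.
  have -> : toM bmx0 = 0 by apply: mx3P; split; rewrite !mxE.
  by rewrite linear0 mulmx0 mul0mx.
have G1 : G sl3_vec = comp1 \/ G sl3_vec = comp2.
  have := eP0; rewrite /G -[F _]bmx_of_mxK -/v1.
  case=> /(congr1 (fun x => toM x)); rewrite !mx_of_bmxM -/P => ->.
    by left; rewrite mulmxK // mx_of_bmxK.
  by right; rewrite mulmxK // mx_of_bmxK.
have tab : standard_table [seq (u, G u) | u <- span_bmx sl3_basis [:: bmx0; sl3_vec]].
  apply: (search_sound GD Gtr Ginj Gdet _ _ span_sl3_uniq (mem_head _ _)) => //.
  rewrite [X in search _ X](_ : _ = [:: (bmx0, G bmx0); (sl3_vec, G sl3_vec)]) // G0.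
  by case: G1 => ->; [exact: search_comp1 | exact: search_comp2].
move: tab; rewrite /standard_table someE => /hasP[Q0 /mem_regular dQ].
set Q := toM Q0; have uQ : Q \in unitmx by rewrite unitmx_bmx.
have uPQ : invmx P *m Q \in unitmx by rewrite unitmx_mul unitmx_inv uP.
have sol (M : 'M[K]_3) (N : 'M[K]_3) : P *m F M *m invmx P *m Q = Q *m N ->
    F M = 1 *: (invmx P *m Q *m N *m invmx (invmx P *m Q)).
  move=> e; rewrite scale1r -(mulmxA _ Q) -e.
  have -> : invmx (invmx P *m Q) = invmx Q *m P.
    by rewrite -[RHS](mulmxK uPQ) mulmxA mulmxK // mulVmx // mul1mx.
  by rewrite !mulmxA mulVmx // mul1mx mulmxK // mulmxKV.
case: ifP => [tab _|_ tab]; exists (invmx P *m Q), 1; split; rewrite ?oner_eq0 //.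
  left=> M /eqP trM; apply: sol; move: tab; rewrite everyE => /allP tab.
  rewrite -[M]bmx_of_mxK mxtrace_bmx in trM.
  have {tab trM} /bmx_eqP e : bmx_eq (bmx_mul (G (ofM M)) Q0) (bmx_mul Q0 (ofM M)) :=
    tab _ (map_f (fun u => (u, G u)) (span_sl3 trM)).
  by have := congr1 (fun x => toM x) e; rewrite !mx_of_bmxM GE bmx_of_mxK.
right=> M /eqP trM; apply: sol; move: tab; rewrite everyE => /allP tab.
rewrite -[M]bmx_of_mxK mxtrace_bmx in trM.
have {tab trM} /bmx_eqP e :
    bmx_eq (bmx_mul (G (ofM M)) Q0) (bmx_mul Q0 (bmx_tr (ofM M))) :=
  tab _ (map_f (fun u => (u, G u)) (span_sl3 trM)).
by have := congr1 (fun x => toM x) e; rewrite !mx_of_bmxM mx_of_bmx_tr GE bmx_of_mxK.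
Qed.

End TwoElements.

(** * Annihilators and leading positions in spaces of matrices *)

(** The entrywise bilinear pairing [\sum_(i, j) v i j * t i j]. *)
Definition mxdot (K : fieldType) (n : nat) (v t : 'M[K]_n) : K :=
  \tr (v^T *m t).

(** Every matrix annihilated by [T] is singular. *)
Definition singular_annihilator (K : fieldType) (n : nat)
    (T : {vspace 'M[K]_n}) : Prop :=
  forall v, (forall t, t \in T -> mxdot v t = 0) -> v \notin unitmx.

Section Dot.

Variables (K : fieldType) (n : nat).
Implicit Types (v t : 'M[K]_n) (T U : {vspace 'M[K]_n}).

Lemma mxdotE v t : mxdot v t = \sum_i \sum_j v i j * t i j.
Proof.
rewrite /mxdot /mxtrace exchange_big /=; apply: eq_bigr => j _.
by rewrite mxE; apply: eq_bigr => i _; rewrite mxE.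
Qed.

Lemma mxdotC v t : mxdot v t = mxdot t v.
Proof. by rewrite /mxdot -mxtrace_tr trmx_mul trmxK. Qed.

Lemma mxdot_tr v t : mxdot v^T t^T = mxdot v t.
Proof. by rewrite /mxdot trmxK -mxtrace_tr trmx_mul trmxK mxtrace_mulC. Qed.

Lemma mxdot_mul v P t Q : mxdot v (P *m t *m Q) = mxdot (P^T *m v *m Q^T) t.
Proof.
by rewrite /mxdot !trmx_mul !trmxK !mulmxA mxtrace_mulC !mulmxA.
Qed.

Lemma mxdotDr v t u : mxdot v (t + u) = mxdot v t + mxdot v u.
Proof. by rewrite /mxdot mulmxDr mxtraceD. Qed.

Lemma mxdotZr v a t : mxdot v (a *: t) = a * mxdot v t.
Proof. by rewrite /mxdot -scalemxAr mxtraceZ. Qed.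

Lemma mxdot_suml (I : finType) (P : pred I) (v : I -> 'M[K]_n) t :
  mxdot (\sum_(i | P i) v i) t = \sum_(i | P i) mxdot (v i) t.
Proof. by rewrite /mxdot linear_sum mulmx_suml linear_sum. Qed.

Lemma mxdot_delta v i j : mxdot v (delta_mx i j) = v i j.
Proof.
rewrite mxdotE (bigD1 i) //= (bigD1 j) //= mxE !eqxx mulr1.
rewrite !big1 ?addr0 // => [i' ni|j' nj]; last first.
  by rewrite mxE eqxx (negbTE nj) mulr0.
by rewrite big1 // => j' _; rewrite mxE (negbTE ni) mulr0.
Qed.

(** Every linear functional is the pairing with some matrix. *)
Lemma mxdot_functional (phi : {linear 'M[K]_n -> K^o}) :
  exists v, forall t, mxdot v t = phi t.
Proof.
exists (\matrix_(i, j) phi (delta_mx i j)) => t.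
rewrite mxdotE [in RHS](matrix_sum_delta t) linear_sum; apply: eq_bigr => i _.
rewrite linear_sum; apply: eq_bigr => j _.
by rewrite mxE linearZ /= mulrC.
Qed.

(** A matrix outside a subspace is separated from it by the pairing. *)
Lemma separate_mxdot U t : t \notin U ->
  exists v, (forall u, u \in U -> mxdot v u = 0) /\ mxdot v t = 1.
Proof.
move=> tU; have d0 : t - projv U t != 0.
  by apply: contra tU; rewrite subr_eq0 => /eqP->; exact: memv_proj.
have [[i j] /= dij] : exists p : 'I_n * 'I_n, (t - projv U t) p.1 p.2 != 0.
  apply/existsP; apply: contraNT d0; rewrite negb_exists => /forallP d0.
  apply/eqP/matrixP => i j; rewrite [RHS]mxE; apply/eqP.
  by have := d0 (i, j); rewrite negbK.
pose phi x : K^o := ((t - projv U t) i j)^-1 * (x - projv U x) i j.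
have phiL : linear phi.
  by move=> a x y; rewrite /phi linearP !mxE /=; rewrite /GRing.scale /=; ring.
pose L := GRing.isLinear.Build K 'M[K]_n K^o _ phi phiL.
pose phi' : {linear 'M[K]_n -> K^o} := HB.pack phi L.
have [v vE] := mxdot_functional phi'.
exists v; split=> [u uU|]; rewrite vE /= /phi; last by rewrite mulVf.
by rewrite (projv_id uU) subrr [X in _ * X]mxE mulr0.
Qed.

Lemma mem_double_annihilator T s :
  (forall v, (forall t, t \in T -> mxdot v t = 0) -> mxdot v s = 0) -> s \in T.
Proof.
move=> Ts; apply: contraT => /separate_mxdot[v [/Ts-> /eqP]].
by rewrite eq_sym oner_eq0.
Qed.

End Dot.

(** The positions of a matrix are ordered by an injective weight [w]. *)
Section Leads.

Variables (K : fieldType) (n : nat).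
Variable (w : 'I_n -> 'I_n -> nat).
Hypothesis w_inj : forall i j i' j', w i j = w i' j' -> i = i' /\ j = j'.
Implicit Types (T : {vspace 'M[K]_n}).

(** The entries of [t] of weight less than [k], all others being replaced by zero. *)
Definition before_mx (k : nat) (t : 'M[K]_n) : 'M[K]_n :=
  \matrix_(i, j) if (w i j < k)%N then t i j else 0.

Fact before_mx_is_linear k : linear (before_mx k).
Proof.
by move=> a x y; apply/matrixP=> i j; rewrite !mxE; case: ifP; rewrite ?mulr0 ?addr0.
Qed.
HB.instance Definition _ k := GRing.isLinear.Build K 'M[K]_n 'M[K]_n _
  (before_mx k) (before_mx_is_linear k).

(** The matrices whose entries of weight less than [k] all vanish. *)
Definition late k : {vspace 'M[K]_n} := lker (linfun (before_mx k)).

Lemma mem_late k (t : 'M[K]_n) : reflect (forall i j, (w i j < k)%N -> t i j = 0) (t \in late k).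
Proof.
rewrite memv_ker lfunE /=; apply: (iffP eqP) => [/matrixP t0 i j wk|t0].
  by have := t0 i j; rewrite !mxE wk.
by apply/matrixP => i j; rewrite !mxE; case: ifP => // /t0.
Qed.

(** [(i, j)] is the position of smallest weight in the support of some [t] in [T]. *)
Definition lead T i j : bool := ~~ (T :&: late (w i j) <= late (w i j).+1)%VS.

Lemma leadP T i j :
  reflect (exists t, [/\ t \in T, t i j != 0
                       & forall i' j', (w i' j' < w i j)%N -> t i' j' = 0])
          (lead T i j).
Proof.
rewrite /lead; apply: (iffP (@subvPn _ _ (T :&: late (w i j))%VS (late (w i j).+1))) => [[t]|[t [tT tij t0]]].
  rewrite memv_cap => /andP[tT /mem_late t0] tl.
  exists t; split=> //; apply: contra tl => /eqP tij; apply/mem_late => i' j'.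
  by rewrite ltnS leq_eqVlt => /orP[/eqP/w_inj[-> ->] //|/t0].
exists t; first by rewrite memv_cap tT; apply/mem_late.
by apply: contra tij => /mem_late->.
Qed.

(** Every non-zero entry is preceded by, or is, a lead of its matrix. *)
Lemma lead_ex T t i j : t \in T -> t i j != 0 ->
  exists i' j', [/\ lead T i' j', t i' j' != 0 & (w i' j' <= w i j)%N].
Proof.
move=> tT tij; pose P (p : 'I_n * 'I_n) := t p.1 p.2 != 0.
have Pij : P (i, j) by [].
case: (arg_minnP (fun p => w p.1 p.2) Pij) => -[i' j'] /= Pij' min_ij.
exists i', j'; split=> //; last exact: (min_ij (i, j)).
apply/leadP; exists t; split=> // k l lt_kl; apply/eqP; apply: contraLR lt_kl => tkl.
by rewrite -leqNgt; exact: (min_ij (k, l)).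
Qed.

(** The subspaces [T :&: late k] decrease strictly at each lead. *)
Lemma card_lead T : (#|[set p | lead T p.1 p.2]| <= \dim T)%N.
Proof.
have step k : (#|[set p : 'I_n * 'I_n | lead T p.1 p.2 && (w p.1 p.2 < k)]|
               + \dim (T :&: late k) <= \dim T)%N.
  elim: k => [|k IHk].
    rewrite (_ : [set p | _] = set0) ?cards0 ?dimvS ?capvSl //.
    by apply/setP => p; rewrite !inE andbF.
  apply: leq_trans IHk.
  have sub : (T :&: late k.+1 <= T :&: late k)%VS.
    apply/subvP => t; rewrite !memv_cap => /andP[-> /mem_late t0].
    by apply/mem_late => i j ltk; apply: t0; exact: ltnW.
  case: (pickP (fun p => lead T p.1 p.2 && (w p.1 p.2 == k))) => [p|no_p].
    case/andP => lead_p /eqP wp.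
    have -> : [set q | lead T q.1 q.2 && (w q.1 q.2 < k.+1)%N]
            = p |: [set q | lead T q.1 q.2 && (w q.1 q.2 < k)%N].
      apply/setP => q; rewrite !inE ltnS leq_eqVlt andb_orr orbC -wp.
      case: (q =P p) => [->|nqp]; first by rewrite lead_p eqxx orbT.
      rewrite orbC; case: (w _ _ =P w _ _) => [/w_inj[]|_]; last by rewrite andbF.
      by case: p q {lead_p wp} nqp => [? ?] [? ?] /= nqp e1 e2; case: nqp; rewrite e1 e2.
    rewrite cardsU1 inE wp ltnn andbF add1n addSn -addnS leq_add2l.
    rewrite ltnNge; apply: contra lead_p => le_dim.
    have : (T :&: late k <= T :&: late k.+1)%VS by rewrite -(dimv_leqif_sup sub) eqn_leq dimvS.
    by rewrite subv_cap => /andP[_]; rewrite wp.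
  rewrite leq_add ?dimvS // subset_leq_card //; apply/subsetP => q.
  rewrite !inE ltnS leq_eqVlt => /andP[lead_q]; rewrite lead_q.
  by case/orP => // wq; have := no_p q; rewrite lead_q wq.
have [k ltk] : exists k, forall p : 'I_n * 'I_n, (w p.1 p.2 < k)%N.
  exists (\max_(p : 'I_n * 'I_n) w p.1 p.2).+1 => p.
  by rewrite ltnS (leq_bigmax p).
apply: leq_trans (step k); rewrite -[X in (X <= _)%N]addn0 leq_add //.
by apply: subset_leq_card; apply/subsetP => p; rewrite !inE ltk andbT.
Qed.

(** At a position that is not a lead, the dual echelon form provides a matrix
    annihilated by [T] whose last non-zero entry is there. *)
Lemma not_lead_dual T i j : ~~ lead T i j ->
  exists v, [/\ forall t, t \in T -> mxdot v t = 0, v i j = 1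
              & forall i' j', (w i j < w i' j')%N -> v i' j' = 0].
Proof.
move=> nlead; have /separate_mxdot[v [vU v1]] : delta_mx i j \notin (T + late (w i j).+1)%VS.
  apply: contra nlead => /memv_addP[t tT [r /mem_late r0 e]].
  have tE : t = delta_mx i j - r by rewrite e addrK.
  apply/leadP; exists t; split=> //.
    by rewrite tE !mxE !eqxx r0 // subr0 oner_eq0.
  move=> i' j' lt_ij; rewrite tE !mxE r0 1?ltnW // subr0.
  by case: eqP => [ei|] //; case: eqP => [ej|] //; rewrite ei ej ltnn in lt_ij.
exists v; split=> [t tT||i' j' lt_ij].
- by apply: vU; rewrite -[t]addr0 memv_add ?mem0v.
- by rewrite -mxdot_delta.
rewrite -mxdot_delta; apply: vU; rewrite -[delta_mx _ _]add0r memv_add ?mem0v //.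
apply/mem_late => k l lt_kl; rewrite mxE.
by case: eqP => [ei|] //; case: eqP => [ej|] //; move: lt_kl; rewrite ei ej ltnS leqNgt lt_ij.
Qed.

End Leads.

(** * Transversals avoiding the leading positions *)

Section MixedDiscriminant.

Variables (K : fieldType) (n : nat).

(** Inclusion and exclusion: the signed sum over the sets that contain [A] vanishes
    unless [A] is the full set. *)
Lemma sum_sign_supset (A : {set 'I_n}) :
  \sum_(S : {set 'I_n} | A \subset S) (-1) ^+ #|S| =
    if A == setT then (-1) ^+ n else 0 :> K.
Proof.
case: eqP => [->|/eqP AT].
  rewrite (big_pred1 setT) ?cardsT ?card_ord // => S.
  by rewrite subTset.
have [x xA] : exists x, x \notin A.
  apply/existsP; apply: contraNT AT; rewrite negb_exists => /forallP xA.
  by apply/eqP/setP => x; rewrite inE; have := xA x; rewrite negbK.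
rewrite (bigID (fun S : {set 'I_n} => x \in S)) /=.
rewrite (reindex_onto (fun S : {set 'I_n} => x |: S) (fun S => S :\ x)) /=; last first.
  by move=> S /andP[_ xS]; rewrite setD1K.
rewrite -[RHS](addNr (\sum_(S : {set 'I_n} | (A \subset S) && (x \notin S)) (-1) ^+ #|S|)).
congr (_ + _); rewrite -sumrN; apply: eq_big => S.
  have [xS|xS] := boolP (x \in S).
    rewrite andbF; case: eqP => [e|]; last by rewrite andbF.
    by move: xS; rewrite -e !inE eqxx.
  rewrite setU11 setU1K // eqxx !andbT.
  apply/subsetP/subsetP => AS y yA; last by rewrite inE AS // orbT.
  have := AS y yA; rewrite !inE; case: eqP => // yx.
  by rewrite -yx yA in xA.
case/andP => _ /eqP e; have xS : x \notin S by rewrite -e !inE eqxx.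
by rewrite cardsU1 xS exprS mulN1r.
Qed.

(** The coefficient of the squarefree monomial in the determinant of a generic
    linear combination of [n] matrices, by inclusion and exclusion. *)
Lemma sum_sign_det (v : 'I_n -> 'M[K]_n) :
  \sum_(S : {set 'I_n}) (-1) ^+ #|S| * \det (\sum_(k in S) v k) =
  (-1) ^+ n * \sum_(s : 'S_n) (-1) ^+ s *
    \sum_(g : {ffun 'I_n -> 'I_n} | g @: setT == setT) \prod_i v (g i) i (s i).
Proof.
transitivity (\sum_(S : {set 'I_n}) \sum_(s : 'S_n)
    \sum_(g : {ffun 'I_n -> 'I_n} | g @: setT \subset S)
      (-1) ^+ #|S| * ((-1) ^+ s * \prod_i v (g i) i (s i))).
  apply: eq_bigr => S _; rewrite mulr_sumr; apply: eq_bigr => s _.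
  rewrite -mulr_sumr -mulr_sumr; congr (_ * (_ * _)).
  transitivity (\prod_i \sum_(k in S) v k i (s i)).
    by apply: eq_bigr => i _; rewrite summxE.
  rewrite bigA_distr_big; apply: eq_bigl => g.
  apply/ffun_onP/subsetP => [gS _ /imsetP[i _ ->] //|gS i].
  by apply: gS; exact: imset_f.
rewrite exchange_big mulr_sumr; apply: eq_bigr => s _ /=.
rewrite (exchange_big_dep predT) //= mulrCA mulr_sumr mulr_sumr.
rewrite [RHS]big_mkcond; apply: eq_bigr => g _ /=.
rewrite -mulr_suml sum_sign_supset; case: eqP => _; rewrite ?mul0r //.
by rewrite mulrCA.
Qed.

(** If the last non-zero entries of the matrices [v k], for an order on the
    positions induced by an additive weight, are the positions of a permutation
    matrix, then some sum of matrices [v k] is regular. *)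
Lemma transversal_unitmx (a b : 'I_n -> nat) (s : 'S_n) (v : 'I_n -> 'M[K]_n) :
  (forall i j i' j', (a i + b j = a i' + b j')%N -> i = i' /\ j = j') ->
  (forall k, v k k (s k) = 1) ->
  (forall k i j, (a k + b (s k) < a i + b j)%N -> v k i j = 0) ->
  exists S : {set 'I_n}, \sum_(k in S) v k \in unitmx.
Proof.
move=> w_inj v1 v0; apply/existsP; apply: contraT; rewrite negb_exists => /forallP sing.
suff : \sum_(S : {set 'I_n}) (-1) ^+ #|S| * \det (\sum_(k in S) v k) != 0.
  rewrite big1 ?eqxx // => S _; have := sing S.
  by rewrite unitmxE unitfE negbK => /eqP->; rewrite mulr0.
rewrite sum_sign_det mulf_neq0 ?signr_eq0 //.
have key (t : 'S_n) (g : {ffun 'I_n -> 'I_n}) : g @: setT == setT ->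
    \prod_i v (g i) i (t i) != 0 -> (forall i, g i = i) /\ t = s.
  move=> /eqP gT /prodf_neq0 nz.
  have g_inj : injective g.
    have : {in setT &, injective g} by apply/imset_injP; rewrite gT.
    by move=> gi x y; apply: gi; rewrite inE.
  have le i : (a i + b (t i) <= a (g i) + b (s (g i)))%N.
    by rewrite leqNgt; apply: contra (nz i isT) => /v0->.
  (* An additive weight has the same total over all permutations. *)
  have eq_sum : (\sum_i (a i + b (t i)) = \sum_i (a (g i) + b (s (g i))))%N.
    rewrite !big_split /=; congr (_ + _)%N.
      by rewrite (reindex_inj g_inj).
    transitivity (\sum_i b i)%N.
      by rewrite [RHS](reindex_inj (@perm_inj _ t)).
    by rewrite (reindex_inj (inj_comp (@perm_inj _ s) g_inj)).
  have eq_w i : (a i + b (t i) = a (g i) + b (s (g i)))%N.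
    apply/eqP; rewrite eqn_leq le /= leqNgt; apply/negP => lt.
    have : (\sum_i (a i + b (t i)) < \sum_i (a (g i) + b (s (g i))))%N.
      by rewrite (bigD1 i) //= [X in (_ < X)%N](bigD1 i) //= -addSn leq_add // leq_sum.
    by rewrite eq_sum ltnn.
  have gi i : g i = i by have [] := w_inj _ _ _ _ (eq_w i).
  split=> //; apply/permP => i.
  by have [_ ->] := w_inj _ _ _ _ (eq_w i); rewrite gi.
rewrite (bigD1 s) //= [X in _ + X]big1 ?addr0; last first.
  move=> t /negP ts; rewrite big1 ?mulr0 // => g gT; apply/eqP.
  by apply: contraT => /(key _ _ gT)[_ /eqP].
rewrite mulf_neq0 ?signr_eq0 // (bigD1 [ffun i => i]) /=; last first.
  by apply/eqP/setP => i; rewrite inE; apply/imsetP; exists i; rewrite ?inE ?ffunE.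
rewrite [X in _ + X]big1 ?addr0; last first.
  move=> g /andP[gT /negP ng].
  apply/eqP; apply: contraT => /(key _ _ gT)[gi _]; case: ng.
  by apply/eqP/ffunP => i; rewrite ffunE.
by rewrite big1 ?oner_eq0 // => i _; rewrite ffunE v1.
Qed.

End MixedDiscriminant.

(** A set [L] of positions is avoided by a permutation if it contains no
    [(i, s i)]. *)
Section AvoidingPermutation.

Variable n : nat.
Implicit Types (L : {set 'I_n.+1 * 'I_n.+1}).

Let row_part L i := [set p in L | p.1 == i].
Let col_part L j := [set p in L | p.2 == j].

(** The trace of [L] on the positions outside row [i] and column [j]. *)
Let minor L i j : {set 'I_n * 'I_n} :=
  [set p | (lift i p.1, lift j p.2) \in L].

Lemma avoid_of_minor L i j (s : 'S_n) : (i, j) \notin L ->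
  (forall k, (k, s k) \notin minor L i j) ->
  forall k, (k, lift_perm i j s k) \notin L.
Proof.
move=> ijL sL k; case: (unliftP i k) => [k'|] ->; last by rewrite lift_perm_id.
by rewrite lift_perm_lift; have := sL k'; rewrite inE.
Qed.

Lemma card_minor L i j : (i, j) \notin L ->
  (#|minor L i j| + (#|row_part L i| + #|col_part L j|) <= #|L|)%N.
Proof.
move=> ijL; pose h (p : 'I_n * 'I_n) := (lift i p.1, lift j p.2).
have h_inj : injective h.
  move=> [a b] [a' b'] e.
  rewrite (lift_inj (congr1 fst e : lift i a = lift i a')).
  by rewrite (lift_inj (congr1 snd e : lift j b = lift j b')).
rewrite -(card_imset _ h_inj) -cardsUI.
have -> : row_part L i :&: col_part L j = set0.
  apply/setP => -[k l]; rewrite !inE /=; apply/negbTE; apply: contra ijL.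
  by case/andP => /andP[klL /eqP <-] /andP[_ /eqP <-].
rewrite cards0 addn0 -cardsUI.
have -> : h @: minor L i j :&: (row_part L i :|: col_part L j) = set0.
  apply/setP => p; rewrite !inE; apply/negbTE/negP => /andP[/imsetP[q _ ->]] /=.
  by rewrite (eq_sym _ i) (eq_sym _ j) !(negbTE (neq_lift _ _)) !andbF.
rewrite cards0 addn0 subset_leq_card //; apply/subsetP => p; rewrite !inE.
by case/or3P => [/imsetP[q + ->]|/andP[]|/andP[]] //; rewrite inE.
Qed.

Lemma card_row_part L : #|L| = (\sum_i #|row_part L i|)%N.
Proof.
rewrite -sum1_card (partition_big (fun p => p.1) predT) //=.
by apply: eq_bigr => i _; rewrite -sum1_card; apply: eq_bigl => p; rewrite !inE.
Qed.

Lemma card_col_part L : #|L| = (\sum_j #|col_part L j|)%N.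
Proof.
rewrite -sum1_card (partition_big (fun p => p.2) predT) //=.
by apply: eq_bigr => i _; rewrite -sum1_card; apply: eq_bigl => p; rewrite !inE.
Qed.

Lemma card_row_index L i : #|row_part L i| = #|[set j | (i, j) \in L]|.
Proof.
have inj : injective (fun j : 'I_n.+1 => (i, j)) by move=> ? ? [].
rewrite -(card_imset _ inj); apply: eq_card => -[k l].
rewrite !inE /=; apply/andP/imsetP => [[klL /eqP ki]|[j + [-> ->]]].
  by exists l; rewrite ?inE -ki.
by rewrite inE eqxx.
Qed.

End AvoidingPermutation.

(** Removing the row of an element of [L] and a column that meets that row outside
    [L] decreases both the order and the cardinal of [L]. *)
Lemma avoiding_perm_small n (L : {set 'I_n * 'I_n}) :
  (#|L| < n)%N -> exists s : 'S_n, forall i, (i, s i) \notin L.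
Proof.
elim: n L => [//|n IHn] L ltL.
have [->|[[i j0] ijL]] := set_0Vmem L; first by exists 1%g => i; rewrite inE.
have [j ijN] : exists j, (i, j) \notin L.
  apply/existsP; apply: contraLR ltL; rewrite negb_exists -leqNgt => /forallP all_j.
  rewrite -[X in (X <= _)%N]card_ord -cardsT.
  have inj : injective (fun j : 'I_n.+1 => (i, j)) by move=> ? ? [].
  rewrite -(card_imset _ inj) subset_leq_card //; apply/subsetP => _ /imsetP[j _ ->].
  by have := all_j j; rewrite negbK.
have le_minor := card_minor ijN.
have [|s sP] := IHn [set p | (lift i p.1, lift j p.2) \in L]; last first.
  by exists (lift_perm i j s); exact: avoid_of_minor ijN sP.
rewrite -ltnS; apply: leq_trans ltL; rewrite ltnS; apply: leq_trans le_minor.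
rewrite -[X in (X < _)%N]addn0 ltn_add2l ltn_addr //.
by apply/card_gt0P; exists (i, j0); rewrite !inE ijL eqxx.
Qed.

(** A special case of the theorem of Frobenius and Koenig. A position outside [L]
    whose row and column together contain enough elements of [L] is chosen for the
    permutation; the remaining minor of [L] is then small. The bound on [n] excludes
    the squares of side two in order three. *)
Lemma avoiding_perm n (L : {set 'I_n * 'I_n}) :
  (3 < n)%N -> (#|L| <= n.+1)%N ->
  (forall i, exists j, (i, j) \notin L) -> (forall j, exists i, (i, j) \notin L) ->
  exists s : 'S_n, forall i, (i, s i) \notin L.
Proof.
case: n L => // n L n_gt leL rowN colN.
set r := fun i => #|[set p in L | p.1 == i]|.
set c := fun j => #|[set p in L | p.2 == j]|.
have [|geL] := ltnP #|L| n.+1; first exact: avoiding_perm_small.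
have finish i j : (i, j) \notin L -> (#|L| < n + (r i + c j))%N ->
    exists s : 'S_n.+1, forall i, (i, s i) \notin L.
  move=> ijN lt.
  have [|s sP] := @avoiding_perm_small n [set p | (lift i p.1, lift j p.2) \in L]; last first.
    by exists (lift_perm i j s); exact: avoid_of_minor ijN sP.
  rewrite -(ltn_add2r (r i + c j)); apply: leq_ltn_trans lt; exact: card_minor.
case: (pickP (fun i => 2 < r i)%N) => [i ri|r2].
  by have [j ijN] := rowN i; apply: finish ijN _; lia.
case: (pickP (fun j => 2 < c j)%N) => [j cj|c2].
  by have [i ijN] := colN j; apply: finish ijN _; lia.
have c_gt0 i j : (i, j) \in L -> (0 < c j)%N.
  by move=> ijL; apply/card_gt0P; exists (i, j); rewrite !inE ijL eqxx.
have r_gt0 i j : (i, j) \in L -> (0 < r i)%N.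
  by move=> ijL; apply/card_gt0P; exists (i, j); rewrite !inE ijL eqxx.
case: (pickP (fun i => 1 < r i)%N) => [i ri|r1].
  have [leL'|gtL] := leqP #|L| n.+1.
    by have [j ijN] := rowN i; apply: finish ijN _; lia.
  have [[i' j]] : exists p : 'I_n.+1 * 'I_n.+1, (p \in L) && ((i, p.2) \notin L).
    apply/existsP; apply: contraLR gtL; rewrite negb_exists -leqNgt => /forallP Lrow.
    suff : (#|L| <= 4)%N by move/leq_trans; apply.
    rewrite card_col_part (bigID (fun j => (i, j) \in L)) /=.
    rewrite [X in (_ + X)%N]big1 ?addn0 => [|j ijN]; last first.
      apply/eqP; rewrite cards_eq0; apply/eqP/setP => p; rewrite !inE.
      apply/negbTE/negP => /andP[pL /eqP pj].
      by have := Lrow p; rewrite pL pj ijN.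
    have le4 : (\sum_(j | (i, j) \in L) 2 <= 2 * 2)%N.
      rewrite sum_nat_const leq_mul2r /= leqNgt.
      by have := negbT (r2 i); rewrite /r card_row_index cardsE.
    apply: leq_trans le4; apply: leq_sum => j _.
    by rewrite leqNgt; exact: negbT (c2 j).
  case/andP => ijL /= ijN; apply: finish ijN _; have := c_gt0 _ _ ijL; lia.
have [[i j] ijL] : exists p, p \in L.
  by apply/card_gt0P; lia.
have [i0 i0N] := colN j.
have [[i' j']] : exists p, (p \in L) && (p.2 != j).
  apply/existsP; apply: contraLR geL; rewrite negb_exists -ltnNge => /forallP Lj.
  have sub : L \subset [set (k, j) | k in [set~ i0]].
    apply/subsetP => -[k l] klL; have := Lj (k, l); rewrite klL negbK /= => /eqP lj.
    apply/imsetP; exists k; rewrite ?lj // !inE; apply: contra i0N => /eqP <-.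
    by rewrite -lj.
  rewrite ltnS (leq_trans (subset_leq_card sub)) // (leq_trans (leq_imset_card _ _)) //.
  by rewrite cardsC1 card_ord.
case/andP => ij'L /= jj'.
have ijN : (i, j') \notin L.
  apply: contraFN (r1 i) => ij'L'; rewrite /r card_row_index.
  apply/card_gt1P; exists j, j'; split; rewrite ?inE //; by rewrite eq_sym.
apply: finish ijN _; have := c_gt0 _ _ ij'L; have := r_gt0 _ _ ijL.
have : #|L| = n.+1.
  apply/eqP; rewrite eqn_leq geL andbT card_row_part -[X in (_ <= X)%N]card_ord.
  rewrite -sum1_card leq_sum // => k _; rewrite leqNgt; exact: negbT (r1 k).
lia.
Qed.

(** * Spaces of matrices with singular annihilator, in order at least four *)

(** The spaces of matrices to be classified: their dimension is at most [n + 1],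
    they contain a regular matrix, and they annihilate only singular ones. *)
Definition good_space (K : fieldType) (n : nat) (T : {vspace 'M[K]_n}) : Prop :=
  [/\ (\dim T <= n.+1)%N, singular_annihilator T & exists2 J, J \in T & J \in unitmx].

(** [T] contains all matrices with a given image line, or all matrices with a given
    kernel hyperplane. *)
Definition contains_rank_one_space (K : fieldType) (n : nat)
    (T : {vspace 'M[K]_n}) : Prop :=
  (exists2 y : 'cV[K]_n, y != 0 & forall p : 'rV_n, y *m p \in T) \/
  (exists2 p : 'rV[K]_n, p != 0 & forall y : 'cV_n, y *m p \in T).

Section Transport.

Variables (K : fieldType) (n : nat).
Implicit Types (P Q t : 'M[K]_n) (T : {vspace 'M[K]_n}).

(** The image of [T] under the equivalence [t |-> P *m t *m Q]. *)
Definition mul_space P Q T : {vspace 'M[K]_n} :=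
  (linfun (mulmxr Q \o mulmx P) @: T)%VS.

(** The transposes of the elements of [T]. *)
Definition tr_space T : {vspace 'M[K]_n} := (linfun trmx @: T)%VS.

Lemma mem_mul_space P Q T t : P \in unitmx -> Q \in unitmx ->
  (P *m t *m Q \in mul_space P Q T) = (t \in T).
Proof.
move=> uP uQ; apply/memv_imgP/idP => [[s sT]|tT].
  rewrite lfunE /= => /(congr1 (mulmx^~ (invmx Q))); rewrite !mulmxK //.
  by move=> /(congr1 (mulmx (invmx P))); rewrite !mulKmx // => ->.
by exists t; rewrite ?lfunE.
Qed.

Lemma mem_mul_spaceE P Q T t : P \in unitmx -> Q \in unitmx ->
  (t \in mul_space P Q T) = (invmx P *m t *m invmx Q \in T).
Proof.
move=> uP uQ; rewrite -[RHS](mem_mul_space _ _ uP uQ).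
by rewrite !mulmxA mulmxKV // mulmxV // mul1mx.
Qed.

Lemma mem_tr_space T t : (t \in tr_space T) = (t^T \in T).
Proof.
apply/memv_imgP/idP => [[s sT]|tT]; first by rewrite lfunE /= => ->; rewrite trmxK.
by exists t^T; rewrite ?lfunE /= ?trmxK.
Qed.

Lemma good_mul_space P Q T : P \in unitmx -> Q \in unitmx ->
  good_space T -> good_space (mul_space P Q T).
Proof.
move=> uP uQ [dT sT [J JT uJ]]; split.
- by apply: leq_trans dT; rewrite -[X in (_ <= X)%N](limg_ker_dim (linfun (mulmxr Q \o mulmx P)) T) leq_addl.
- move=> v vT; have /sT : forall t, t \in T -> mxdot (P^T *m v *m Q^T) t = 0.
    by move=> t tT; rewrite -mxdot_mul vT ?mem_mul_space.
  by rewrite !unitmx_mul !unitmx_tr uP uQ andbT.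
by exists (P *m J *m Q); rewrite ?mem_mul_space // !unitmx_mul uP uQ uJ.
Qed.

Lemma good_tr_space T : good_space T -> good_space (tr_space T).
Proof.
move=> [dT sT [J JT uJ]]; split.
- by apply: leq_trans dT; rewrite -[X in (_ <= X)%N](limg_ker_dim (linfun trmx) T) leq_addl.
- move=> v vT; rewrite -unitmx_tr; apply: sT => t tT.
  by rewrite -mxdot_tr trmxK vT // mem_tr_space trmxK.
by exists J^T; rewrite ?mem_tr_space ?trmxK ?unitmx_tr.
Qed.

Lemma contains_mul_space P Q T : P \in unitmx -> Q \in unitmx ->
  contains_rank_one_space (mul_space P Q T) -> contains_rank_one_space T.
Proof.
move=> uP uQ [[y y0 yT]|[p p0 pT]].
  left; exists (invmx P *m y) => [|p].
    by apply: contra y0 => /eqP/(canRL (mulKVmx uP)); rewrite mulmx0 => ->.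
  have := yT (p *m Q); rewrite mem_mul_spaceE //.
  by rewrite !mulmxA mulmxK.
right; exists (p *m invmx Q) => [|y].
  by apply: contra p0 => /eqP/(canRL (mulmxKV uQ)); rewrite mul0mx => ->.
have := pT (P *m y); rewrite mem_mul_spaceE //.
by rewrite !mulmxA mulVmx // mul1mx.
Qed.

Lemma contains_tr_space T :
  contains_rank_one_space (tr_space T) -> contains_rank_one_space T.
Proof.
move=> [[y y0 yT]|[p p0 pT]].
  right; exists y^T; first by rewrite trmx_eq0.
  by move=> x; have := yT x^T; rewrite mem_tr_space trmx_mul trmxK.
left; exists p^T; first by rewrite trmx_eq0.
by move=> x; have := pT x^T; rewrite mem_tr_space trmx_mul trmxK.
Qed.

End Transport.

Section FullLine.

Variables (K : fieldType) (n : nat).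
Variables (a b : 'I_n -> nat) (T : {vspace 'M[K]_n}).
Hypotheses (n_gt3 : (3 < n)%N) (goodT : good_space T).
Hypothesis w_inj : forall i j i' j',
  (a i + b j = a i' + b j')%N -> i = i' /\ j = j'.

Let w i j := (a i + b j)%N.

(** The leads fill a row or a column, and at most one of them lies outside it. All
    later arguments exhibit leads that contradict this alternative. *)
Lemma leads_fill_line :
  (exists i, (forall j, lead w T i j) /\
     forall k l k' l', lead w T k l -> lead w T k' l' ->
       k != i -> k' != i -> k = k' /\ l = l') \/
  (exists j, (forall i, lead w T i j) /\
     forall k l k' l', lead w T k l -> lead w T k' l' ->
       l != j -> l' != j -> k = k' /\ l = l').
Proof.
have [dT sT _] := goodT.
pose L := [set p | lead w T p.1 p.2].
have leL : (#|L| <= n.+1)%N by exact: leq_trans (card_lead w_inj T) dT.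
have extra (M : {set 'I_n * 'I_n}) p q : M \subset L -> #|M| = n ->
    p \in L -> q \in L -> p \notin M -> q \notin M -> p = q.
  move=> ML cM pL qL pM qM; apply/eqP; apply: contraLR leL => pq; rewrite -ltnNge.
  have sub : p |: (q |: M) \subset L.
    by apply/subsetP => x; rewrite !in_setU1 => /or3P[/eqP->|/eqP->|/(subsetP ML)].
  by apply: leq_trans (subset_leq_card sub); rewrite !cardsU1 in_setU1 negb_or pq pM qM cM.
case: (pickP (fun i => [forall j, lead w T i j])) => [i /forallP full|norow].
  left; exists i; split=> // k l k' l' kl kl' ki ki'.
  pose M := [set (i, j) | j in [set: 'I_n]].
  have cM : #|M| = n by rewrite card_imset ?cardsT ?card_ord // => ? ? [].
  have ML : M \subset L by apply/subsetP => _ /imsetP[j _ ->]; rewrite inE /= full.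
  have notM x y : x != i -> (x, y) \notin M.
    by move=> xi; apply/imsetP => -[? _ [/eqP]]; rewrite (negbTE xi).
  have [-> ->] // : (k, l) = (k', l').
  by apply: (extra M) => //; rewrite ?notM // inE.
case: (pickP (fun j => [forall i, lead w T i j])) => [j /forallP full|nocol].
  right; exists j; split=> // k l k' l' kl kl' lj lj'.
  pose M := [set (i, j) | i in [set: 'I_n]].
  have cM : #|M| = n by rewrite card_imset ?cardsT ?card_ord // => ? ? [].
  have ML : M \subset L by apply/subsetP => _ /imsetP[i _ ->]; rewrite inE /= full.
  have notM x y : y != j -> (x, y) \notin M.
    by move=> xi; apply/imsetP => -[? _ [_ /eqP]]; rewrite (negbTE xi).
  have [-> ->] // : (k, l) = (k', l').
  by apply: (extra M) => //; rewrite ?notM // inE.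
have rowN i : exists j, (i, j) \notin L.
  have /negbT := norow i; rewrite negb_forall => /existsP[j ijN].
  by exists j; rewrite inE.
have colN j : exists i, (i, j) \notin L.
  have /negbT := nocol j; rewrite negb_forall => /existsP[i ijN].
  by exists i; rewrite inE.
have [s sL] := avoiding_perm n_gt3 leL rowN colN.
have dual k : exists v : 'M[K]_n, [/\ forall t, t \in T -> mxdot v t = 0,
    v k (s k) = 1 & forall i j, (w k (s k) < w i j)%N -> v i j = 0].
  by apply: not_lead_dual => //; have := sL k; rewrite inE.
have /fin_all_exists[v vP] := dual.
have [S uS] : exists S : {set 'I_n}, \sum_(k in S) v k \in unitmx.
  apply: (transversal_unitmx (s := s) w_inj) => [k|k]; first by case: (vP k).
  by have [_ _] := vP k.
suff /sT/negP[] : forall t, t \in T -> mxdot (\sum_(k in S) v k) t = 0 by [].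
by move=> t tT; rewrite mxdot_suml big1 // => k _; case: (vP k) => ->.
Qed.

End FullLine.

(** ** Weights *)

(** The weights [N * r + c], where [r] ranks the row and [c] the column, order the
    positions row by row, except that a column of rank [N * N] comes after all
    the others. *)
Lemma lex_weight_lt N r c r' c' : (r < N)%N -> (r' < N)%N -> (c < N \/ c = N * N)%N ->
  (N * r + c < N * r' + c')%N ->
  ((c' < N)%N -> (c < N)%N /\ ((r < r')%N \/ r = r' /\ (c < c')%N)) /\
  (c' = (N * N)%N -> (c < N)%N \/ (r < r')%N).
Proof.
move=> rN r'N cN lt; split=> [c'N|c'E].
  have cltN : (c < N)%N by case: cN => // cE; nia.
  split=> //; case: (ltngtP r r') => [|gt|e]; [by left|nia|right].
  by split=> //; move: lt; rewrite e ltn_add2l.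
case: cN => [|cE]; first by left.
by right; move: lt; rewrite cE c'E ltn_add2r ltn_mul2l => /andP[].
Qed.

Lemma lex_weight_eq N r c r' c' : (r < N)%N -> (r' < N)%N ->
  (c < N \/ c = N * N)%N -> (c' < N \/ c' = N * N)%N ->
  (N * r + c = N * r' + c')%N -> r = r' /\ c = c'.
Proof.
move=> rN r'N cN c'N e; suff er : r = r' by split=> //; apply/(@addnI (N * r)%N); rewrite [in RHS]er.
by case: cN => cN; case: c'N => c'N; nia.
Qed.

Section RankOne.

Variables (K : fieldType) (m : nat).
Local Notation n := m.+4.
Implicit Types (T : {vspace 'M[K]_n}) (t : 'M[K]_n).

Lemma rank_row_support t k j : t k j != 0 ->
  (forall i l, i != k -> t i l = 0) -> \rank t = 1.
Proof.
move=> tkj t0; apply/eqP; rewrite eqn_leq lt0n mxrank_eq0; apply/andP; split.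
  have -> : t = delta_mx k 0 *m row k t.
    apply/matrixP => i l; rewrite !mxE big_ord1 !mxE eqxx andbT.
    by case: eqP => [->|/eqP/t0->]; rewrite ?mul1r ?mul0r.
  by rewrite (leq_trans (mxrankM_maxl _ _)) // rank_leq_col.
by apply: contra tkj => /eqP->; rewrite mxE.
Qed.

Lemma rank_col_support t i k : t i k != 0 ->
  (forall j l, l != k -> t j l = 0) -> \rank t = 1.
Proof.
move=> tik t0; rewrite -mxrank_tr; apply: (@rank_row_support _ k i); first by rewrite mxE.
by move=> l j lk; rewrite mxE t0.
Qed.

Lemma two_others (j l : 'I_n) : exists x y : 'I_n,
  [/\ x != y, x != j, x != l, y != j & y != l].
Proof.
have : (1 < #|~: [set j; l]|)%N.
  by have := cardsC [set j; l]; rewrite card_ord cards2; case: (j != l); lia.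
case/card_gt1P => x [y [xD yD xy]]; exists x, y; move: xD yD.
by rewrite !inE !negb_or => /andP[-> ->] /andP[-> ->].
Qed.

Section Weight.

Variables (ra cb : 'I_n -> nat) (N : nat).
Hypotheses (ra_inj : injective ra) (cb_inj : injective cb).
Hypotheses (raN : forall i, (ra i < N)%N).
Hypotheses (cbN : forall j, (cb j < N)%N \/ cb j = (N * N)%N).

Lemma lex_weight_inj i j i' j' :
  (N * ra i + cb j = N * ra i' + cb j')%N -> i = i' /\ j = j'.
Proof. by case/lex_weight_eq => // /ra_inj-> /cb_inj->. Qed.

Let w i j := (N * ra i + cb j)%N.

(** Leads in a column that is not moved to the end, in the row by row order. *)
Lemma lex_leadP T i j : (cb j < N)%N ->
  lead w T i j <-> exists t, [/\ t \in T, t i j != 0 &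
    forall i' j', (cb j' < N)%N -> (ra i' < ra i)%N \/ i' = i /\ (cb j' < cb j)%N ->
      t i' j' = 0].
Proof.
move=> cbj; split=> [/(leadP lex_weight_inj)|] [t [tT tij t0]].
  exists t; split=> // i' j' ltj lt; apply: t0; rewrite /w.
  case: lt => [lt|[-> lt]]; last by rewrite ltn_add2l.
  have := leq_mul (leqnn N) lt; rewrite mulnS.
  by lia.
apply/(leadP lex_weight_inj); exists t; split=> // i' j' lt.
have [/(_ cbj)[cbj' lt'] _] := lex_weight_lt (raN _) (raN _) (cbN _) lt.
by apply: t0 => //; case: lt' => [|[/ra_inj->]]; [left | right].
Qed.

(** Leads in the column that comes after all the others. *)
Lemma lex_lead_lastP T i j : cb j = (N * N)%N ->
  lead w T i j <-> exists t, [/\ t \in T, t i j != 0,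
    forall i' j', j' != j -> t i' j' = 0 & forall i', (ra i' < ra i)%N -> t i' j = 0].
Proof.
move=> cbj; have cbj' j' : j' != j -> (cb j' < N)%N.
  by case: (cbN j') => // e; rewrite (cb_inj (etrans e (esym cbj))) eqxx.
split=> [/(leadP lex_weight_inj)[t [tT tij t0]]|[t [tT tij t0 t1]]].
  exists t; split=> // [i' j' /cbj' lt|i' lt]; apply: t0; rewrite /w cbj.
    by have := raN i'; nia.
  by rewrite ltn_add2r ltn_pmul2l // (leq_ltn_trans _ (raN i)).
apply/(leadP lex_weight_inj); exists t; split=> // i' j' lt.
have [_ /(_ cbj)] := lex_weight_lt (raN _) (raN _) (cbN _) lt.
have [->|/t0-> //] := eqVneq j' j; rewrite cbj; case=> [ltN|/t1//].
by case: N ltN raN => [|N'] // ltN; have := raN i; nia.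
Qed.

End Weight.

(** A space [T] without matrices of rank one has no lead in the last row of a row by
    row order, nor in a column that is moved to the end. The first fact gives a row
    filled with leads; moving a column to the end then leaves too many leads outside
    every line. *)
Lemma good_space_rank_one_id T : good_space T -> 1%:M \in T ->
  exists2 t, t \in T & \rank t = 1.
Proof.
move=> goodT T1; pose N := m.+4.+3; have n_gt3 : (3 < n)%N by [].
have ltnN (x : 'I_n) : (x < N)%N by rewrite (leq_trans (ltn_ord x)) // /N; lia.
(* Row by row, the rows and columns in their natural order. *)
have cbN0 (j : 'I_n) : (j < N \/ j = N * N :> nat)%N by left; exact: ltnN.
have w_inj0 := lex_weight_inj val_inj val_inj ltnN cbN0.
have lead0P := lex_leadP val_inj val_inj ltnN cbN0 T.
have [[i [full _]]|[j [full _]]] := leads_fill_line n_gt3 goodT w_inj0; last first.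
  have [t [tT tnz t0]] := (lead0P _ _ (ltnN _)).1 (full ord_max).
  exists t => //; apply: rank_row_support tnz _ => i l ni; apply: t0; first exact: ltnN.
  by left; rewrite ltn_neqAle -[_ == _]/(i == ord_max) ni -ltnS ltn_ord.
have [t [tT tnz t0]] := (lead0P _ _ (ltnN _)).1 (full ord_max).
(* Unless [t] has rank one, its row [i] is independent of row [i] of the identity. *)
have [e|imax] := eqVneq i ord_max.
  exists t => //; apply: rank_row_support tnz _ => k l ni; apply: t0; first exact: ltnN.
  by left; rewrite e in ni *; rewrite ltn_neqAle -[_ == _]/(k == ord_max) ni -ltnS ltn_ord.
have tii : t i i = 0.
  by apply: t0; [exact: ltnN|right; split=> //]; rewrite ltn_neqAle -[_ == _]/(i == ord_max) imax -ltnS ltn_ord.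
(* Row [i] comes first, then the others; columns [i] and [ord_max] come first. *)
pose ra (k : 'I_n) : nat := if k == i then 0 else k.+1.
pose cb (k : 'I_n) : nat := if k == i then 0 else if k == ord_max then 1 else k.+2.
have ra_inj : injective ra.
  move=> x y; rewrite /ra; case: eqP => [->|_]; case: eqP => // _ [e].
  exact: val_inj.
have cb_inj : injective cb.
  move=> x y; rewrite /cb; have [->|_] := eqVneq x i.
    by have [->|_] := eqVneq y i => //; case: ifP.
  have [->|_] := eqVneq x ord_max.
    by case: ifP => // _; have [->|] := eqVneq y ord_max.
  by case: ifP => // _; case: ifP => // _ [e]; exact: val_inj.
have raN k : (ra k < N)%N.
  by rewrite /ra /N; case: ifP => // _; have := ltn_ord k; lia.
have cb_lt k : (cb k < N)%N.
  by rewrite /cb /N; case: ifP => // _; case: ifP => // _; have := ltn_ord k; lia.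
have cbN k : (cb k < N \/ cb k = N * N)%N by left.
have w_inj1 := lex_weight_inj ra_inj cb_inj raN cbN.
have lead1P := lex_leadP ra_inj cb_inj raN cbN T.
have ra_gt0 k : k != i -> (0 < ra k)%N by rewrite /ra => /negbTE->.
have lead1ii : lead (fun x y => N * ra x + cb y)%N T i i.
  apply: (lead1P _ _ (cb_lt _)).2; exists 1%:M; split=> // [|i' j' _]; first by rewrite mxE eqxx oner_eq0.
  by rewrite /ra /cb eqxx !ltn0 => -[] // [].
have lead1im : lead (fun x y => N * ra x + cb y)%N T i ord_max.
  apply: (lead1P _ _ (cb_lt _)).2; exists t; split=> // i' j' _.
  rewrite /ra eqxx ltn0 => -[] // [->]; rewrite /cb eqxx [ord_max == i]eq_sym (negbTE imax).
  by case: eqP => [->|_] //; case: eqP.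
have [[k [full1 extra1]]|[j [full1 _]]] := leads_fill_line n_gt3 goodT w_inj1; last first.
  have [s [sT snz s0]] := (lead1P _ _ (cb_lt _)).1 (full1 ord_max).
  exists s => //; apply: rank_row_support snz _ => k l nk; apply: s0; first exact: cb_lt.
  left; rewrite /ra [ord_max == i]eq_sym (negbTE imax); case: eqP => // _.
  by rewrite ltnS ltn_neqAle -[_ == _]/(k == ord_max) nk -ltnS ltn_ord.
have {k full1 extra1} full1 j : lead (fun x y => N * ra x + cb y)%N T i j.
  have [<-|ki] := eqVneq k i; first exact: full1.
  rewrite eq_sym in ki; have [_ e] := extra1 _ _ _ _ lead1ii lead1im ki ki.
  by rewrite e eqxx in imax.
(* A column [l] other than these two is moved to the end. *)
have [l [_ [_ li lmax _ _]]] := two_others i ord_max.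
pose cb' (k : 'I_n) : nat := if k == l then (N * N)%N else cb k.
have cb'N k : (cb' k < N \/ cb' k = N * N)%N by rewrite /cb'; case: ifP; [right|left].
have cb'_inj : injective cb'.
  move=> x y; rewrite /cb'; case: eqP => [->|_]; case: eqP => [->|_] // e.
  - by have := cb_lt y; rewrite -e /N; nia.
  - by have := cb_lt x; rewrite e /N; nia.
  exact: cb_inj.
have w_inj2 := lex_weight_inj ra_inj cb'_inj raN cb'N.
have lead2P := lex_leadP ra_inj cb'_inj raN cb'N T.
have lead2lP := lex_lead_lastP ra_inj cb'_inj raN cb'N T.
have cb'E k : k != l -> cb' k = cb k by rewrite /cb' => /negbTE->.
have cb'l : cb' l = (N * N)%N by rewrite /cb' eqxx.
have lead2i j : j != l -> lead (fun x y => N * ra x + cb' y)%N T i j.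
  move=> jl; have cb'N' : (cb' j < N)%N by rewrite cb'E.
  apply: (lead2P _ _ cb'N').2.
  have [s [sT snz s0]] := (lead1P _ _ (cb_lt _)).1 (full1 j); exists s; split=> // i' j' ltN lt.
  apply: s0 => //; case: lt => [|[-> lt]]; [by left|right; split=> //].
  move: lt; rewrite [cb' j]cb'E // /cb'; case: eqP => // _.
  by have := cb_lt j; rewrite /N; nia.
suff [k /(lead2lP _ _ cb'l).1[s [sT snz s0 _]]] : exists k, lead (fun x y => N * ra x + cb' y)%N T k l.
  by exists s => //; apply: rank_col_support snz _.
have [[k [full2 _]]|[j [full2 extra2]]] := leads_fill_line n_gt3 goodT w_inj2; first by exists k.
have [<-|jl] := eqVneq j l; first by exists i.
have [x [y [xy xj xl yj yl]]] := two_others j l.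
by have [_ e] := extra2 _ _ _ _ (lead2i x xl) (lead2i y yl) xj yj; rewrite e eqxx in xy.
Qed.

End RankOne.

Section DeltaInSpace.

Variables (K : fieldType) (m : nat).
Local Notation n := m.+4.
Implicit Types (T : {vspace 'M[K]_n}) (t J : 'M[K]_n).

Local Notation e0 := (delta_mx 0 0 : 'rV[K]_n).

(** Two rows of a regular matrix are not both supported in the same column. *)
Lemma two_rows_off_column J (r1 r2 l : 'I_n) : J \in unitmx -> r1 != r2 ->
  exists r c : 'I_n, [/\ (r == r1) || (r == r2), c != l & J r c != 0].
Proof.
move=> uJ r12.
have kerJ (u : 'rV_n) : u *m J = 0 -> u = 0.
  by move=> uJ0; rewrite -(mulmxK uJ u) uJ0 mul0mx.
case: (pickP (fun p : 'I_n * 'I_n =>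
    [&& (p.1 == r1) || (p.1 == r2), p.2 != l & J p.1 p.2 != 0])) => [[r c] /and3P[? ? ?]|none].
  by exists r, c.
have J0 r c : (r == r1) || (r == r2) -> c != l -> J r c = 0.
  by move=> hr hc; have := none (r, c); rewrite /= hr hc => /eqP.
pose u : 'rV_n := J r2 l *: delta_mx 0 r1 - J r1 l *: delta_mx 0 r2.
have /kerJ u0 : u *m J = 0.
  rewrite mulmxBl -!scalemxAl -!rowE; apply/rowP => c; rewrite !mxE.
  have [->|cl] := eqVneq c l; first by rewrite mulrC subrr.
  by rewrite (J0 r1 c) ?(J0 r2 c) ?eqxx ?orbT // !mulr0 subrr.
have J2 : J r2 l = 0.
  have := congr1 (fun x : 'rV_n => x 0 r1) u0.
  by rewrite !mxE !eqxx (negbTE r12) /= mulr1 mulr0 subr0.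
have /kerJ e : (delta_mx 0 r2 : 'rV_n) *m J = 0.
  rewrite -rowE; apply/rowP => c; rewrite !mxE.
  by have [->|cl] := eqVneq c l; rewrite // J0 ?eqxx ?orbT.
have /eqP := congr1 (fun x : 'rV_n => x 0 r2) e.
by rewrite !mxE !eqxx oner_eq0.
Qed.

Lemma mul_cV_e0 (y : 'cV[K]_n) i j :
  (y *m e0) i j = if j == 0 then y i 0 else 0.
Proof. by rewrite mxE big_ord1 mxE eqxx /=; case: eqP; rewrite ?mulr1 ?mulr0. Qed.

Lemma col_supportE t : (forall i j, j != 0 -> t i j = 0) -> t = col 0 t *m e0.
Proof.
move=> t0; apply/matrixP => i j; rewrite mul_cV_e0 mxE.
by case: eqP => [->|/eqP/t0].
Qed.

(** If the elements of [T] supported in column [0] form a space of dimension at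
    least two, but not the whole column, then two leads of the moved column and a
    third lead in another row contradict [leads_fill_line]. The basis of the rows is
    adapted to that space. *)
Lemma column_part_absurd T (be : nat) : good_space T -> (1 < be < n)%N ->
  (forall y : 'cV_n, y *m e0 \in T <-> forall i : 'I_n, (be <= i)%N -> y i 0 = 0) ->
  False.
Proof.
move=> goodT /andP[be1 ben] colT; pose N := m.+4.+3; have n_gt3 : (3 < n)%N by [].
pose i1 : 'I_n := @Ordinal n 1 isT; pose i2 : 'I_n := @Ordinal n 2 isT.
pose i3 : 'I_n := @Ordinal n 3 isT.
pose ra (r k : 'I_n) : nat := if k == r then 0 else k.+1.
pose cb (k : 'I_n) : nat := if k == 0 then (N * N)%N else k.
have ra_inj r : injective (ra r).
  move=> x y; rewrite /ra; case: eqP => [->|_]; case: eqP => // _ [e].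
  exact: val_inj.
have ltnN (x : 'I_n) : (x.+1 < N)%N by rewrite /N; have := ltn_ord x; lia.
have raN r k : (ra r k < N)%N by rewrite /ra; case: ifP => // _; exact: ltnN.
have cb_inj : injective cb.
  move=> x y; rewrite /cb; case: eqP => [->|_]; case: eqP => [->|_] // e.
  - by have := ltnN y; rewrite -e /N; nia.
  - by have := ltnN x; rewrite e /N; nia.
  exact: val_inj.
have cbN k : (cb k < N \/ cb k = N * N)%N.
  by rewrite /cb; case: ifP; [right|left; exact: ltnW (ltnN k)].
have w_inj r := lex_weight_inj (ra_inj r) cb_inj (raN r) cbN.
have leadP r := lex_leadP (ra_inj r) cb_inj (raN r) cbN T.
have lead0P r := lex_lead_lastP (ra_inj r) cb_inj (raN r) cbN T.
have lead_e r (k : 'I_n) : (k < be)%N -> lead (fun x y => N * ra r x + cb y)%N T k 0.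
  move=> kbe; apply: (lead0P _ _ _ _).2 => //.
  exists (delta_mx k 0 *m e0); split=> [||i j j0|i ltik].
  - by apply/colT => i bei; rewrite mxE; have [ik|//] := eqVneq i k; rewrite -ik ltnNge bei in kbe.
  - by rewrite mul_cV_e0 mxE !eqxx oner_eq0.
  - by rewrite mul_cV_e0 (negbTE j0).
  by rewrite mul_cV_e0 mxE; have [ik|//] := eqVneq i k; rewrite ik ltnn in ltik.
(* A third row with a lead, while row [r] comes first and has none in column [0]. *)
have [r [r3 [c3 [ber r30 r31 lead3]]]] : exists r r3 c3 : 'I_n, [/\ (be <= r)%N, r3 != 0, r3 != i1 &
    lead (fun x y => N * ra r x + cb y)%N T r3 c3].
  have [be3|] := leqP 3 be.
    by exists ord_max, i2, 0; split=> //; exact: lead_e.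
  rewrite ltnS => be2; have {be2} be2 : be = 2 by apply/eqP; rewrite eqn_leq be2.
  have [_ _ [J JT uJ]] := goodT.
  have [r [c [rE c0 Jrc]]] := @two_rows_off_column J i2 i3 0 uJ isT.
  have r2 : (be <= r)%N by rewrite be2; case/orP: rE => /eqP->.
  have /(lead_ex (w_inj r))/(_ Jrc)[r' [c' [lead' _]]] := JT.
  have cc : (cb c < N)%N by rewrite /cb (negbTE c0) ltnW.
  rewrite {2}/ra eqxx muln0 add0n => le'; exists r, r', c'.
  have r'E : r' = r.
    apply/eqP; apply: contraLR le' => r'r; rewrite -ltnNge {1}/ra (negbTE r'r).
    by rewrite mulnS -addnA (leq_trans cc) // leq_addr.
  by rewrite r'E in lead' *; split=> //; apply: contraTneq r2 => ->; rewrite be2.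
have [[i [_ extra]]|[j [full extra]]] := leads_fill_line n_gt3 goodT (w_inj r).
  have l0 := lead_e r 0 (ltnW be1); have l1 := lead_e r i1 be1.
  have [i0|i0] := eqVneq i 0.
    rewrite {i}i0 in extra; have [e _] := extra _ _ _ _ l1 lead3 isT r30.
    by rewrite -e eqxx in r31.
  have [ei1|ni1] := eqVneq i i1.
    rewrite {i i0}ei1 in extra; have [e _] := extra _ _ _ _ l0 lead3 isT r31.
    by rewrite -e eqxx in r30.
  rewrite eq_sym in i0; rewrite eq_sym in ni1.
  by have [] := extra _ _ _ _ l0 l1 i0 ni1.
have [j0|j0] := eqVneq j 0; first rewrite {j}j0 in full extra.
  have cb0 : cb 0 = (N * N)%N by [].
  have [t [tT tr t0 _]] := (lead0P _ _ _ cb0).1 (full r).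
  move: tT; rewrite (col_supportE t0) => /colT/(_ r ber)/eqP.
  by rewrite mxE (negbTE tr).
have l0 := lead_e r 0 (ltnW be1); have l1 := lead_e r i1 be1.
by rewrite eq_sym in j0; have [] := extra _ _ _ _ l0 l1 j0 j0.
Qed.

(** Every space of columns consists of the transposed elements of a row space. *)
Lemma matrix_of_vspace k (U : {vspace 'cV[K]_k}) :
  exists A : 'M[K]_k, forall y : 'cV_k, (y \in U) = (y^T <= A)%MS.
Proof.
exists (<<\matrix_(i < \dim U) ((vbasis U)`_i)^T>>)%MS => y.
rewrite genmxE; apply/idP/submxP => [yU|[D yE]].
  exists (\row_i coord (vbasis U) i y); rewrite {1}(coord_vbasis yU).
  rewrite linear_sum mulmx_sum_row; apply: eq_bigr => i _.
  by rewrite linearZ /= mxE rowK.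
rewrite -[y]trmxK yE mulmx_sum_row linear_sum memv_suml // => i _.
by rewrite linearZ /= rowK trmxK memvZ // vbasis_mem // mem_nth // size_tuple.
Qed.

(** The elements of [T] supported in column [0] form the whole column, or are
    multiples of the single elementary matrix known to be there. *)
Lemma column_part T : good_space T -> delta_mx 0 0 \in T ->
  (forall y : 'cV_n, y *m e0 \in T) \/
  (forall t, t \in T -> (forall i j, j != 0 -> t i j = 0) ->
     forall i, i != 0 -> t i 0 = 0).
Proof.
move=> goodT dT.
have [A AE] := matrix_of_vspace (linfun (mulmxr e0) @^-1: T)%VS.
have {}AE (y : 'cV_n) : (y *m e0 \in T) = (y^T <= A)%MS.
  by rewrite -AE -memv_preim lfunE.
have e0A : (e0 <= A)%MS.
  rewrite -[e0]trmxK -AE trmx_delta; congr (_ \in T): dT.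
  by apply/matrixP => i j; rewrite mul_cV_e0 !mxE; case: (j =P 0) => //; rewrite andbF.
have [rk1|rk] := leqP (\rank A) 1.
  right=> t tT t0 i i0.
  have eqA : (A <= e0)%MS.
    by rewrite -(geq_leqif (mxrank_leqif_sup e0A)) mxrank_delta.
  have : ((col 0 t)^T <= e0)%MS by apply: submx_trans eqA; rewrite -AE -col_supportE.
  case/submxP => D /matrixP/(_ 0 i); rewrite !mxE big_ord1 !mxE eqxx.
  by rewrite (negbTE i0) mulr0.
have [full|nfull] := eqVneq (\rank A) n.
  by left=> y; rewrite AE submx_full //; apply/eqP.
have lt_rk : (\rank A < n)%N by rewrite ltn_neqAle nfull rank_leq_row.
exfalso; pose P := (invmx (row_ebase A))^T.
have uR := row_ebase_unit A.
have uP : P \in unitmx by rewrite unitmx_tr unitmx_inv.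
apply: (@column_part_absurd (mul_space P 1%:M T) (\rank A)); first exact: good_mul_space (unitmx1 _ _) goodT.
  by rewrite rk.
move=> y; rewrite mem_mul_spaceE ?unitmx1 // invmx1 mulmx1 mulmxA AE.
rewrite trmx_mul /P -trmx_inv invmxK trmxK -[X in (_ <= X)%MS]mulmx_ebase.
have -> : (y^T *m row_ebase A <= col_ebase A *m pid_mx (\rank A) *m row_ebase A)%MS
    = (y^T <= (pid_mx (\rank A) : 'M_n))%MS.
  rewrite submxMfree ?row_free_unit //.
  have full : row_full (col_ebase A) by rewrite row_full_unit col_ebase_unit.
  by rewrite (eqmxMfull _ full).
split=> [/submxP[D yE] i le_i|y0].
  have := congr1 (fun x : 'rV_n => x 0 i) yE; rewrite !mxE => ->.
  by rewrite big1 // => k _; rewrite mxE; case: eqP => [->|]; rewrite ?ltnNge ?le_i ?mulr0.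
apply/submxP; exists y^T; apply/rowP => i; rewrite !mxE (bigD1 i) //= big1 ?addr0.
  by rewrite !mxE eqxx; case: ltnP => [_|/y0->]; rewrite ?mulr1 ?mul0r.
by move=> k ki; rewrite !mxE -[val k == val i]/(k == i) (negbTE ki) mulr0.
Qed.

End DeltaInSpace.

Section CrossCase.

Variables (K : fieldType) (m : nat).
Local Notation n := m.+4.
Implicit Types (T : {vspace 'M[K]_n}) (t J : 'M[K]_n).

Let i1 : 'I_n := @Ordinal n 1 isT.
Let i2 : 'I_n := @Ordinal n 2 isT.

(** It remains to exclude that the multiples of [delta_mx 0 0] are the only elements
    of [T] supported in row [0], and the only ones supported in column [0]. Two
    orders that differ only in their last row and column show that [T] is spanned by
    one regular matrix and by matrices supported in row [0] and column [0] together;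
    an order of the columns then has two leads in each of its first two columns, and
    no line contains more than two of these four. *)
Lemma delta_in_space_absurd T : good_space T -> delta_mx 0 0 \in T ->
  (forall t, t \in T -> (forall i j, j != 0 -> t i j = 0) ->
     forall i, i != 0 -> t i 0 = 0) ->
  (forall t, t \in T -> (forall i j, i != 0 -> t i j = 0) ->
     forall j, j != 0 -> t 0 j = 0) ->
  False.
Proof.
move=> goodT dT colT rowT; have n_gt3 : (3 < n)%N by [].
have [N NE] : exists N, N = n.+3 by exists n.+3.
have ltnN (x : 'I_n) : (x < n)%N by [].
have mulN (x : 'I_n) : (N * x + N <= N * n)%N by rewrite -mulnSr leq_mul.
have NN : (N * n + N + N + N = N * N)%N by rewrite -!mulnSr -NE.
have nN : (n.+2 < N)%N by rewrite NE.
have N_gt0 : (0 < N)%N by rewrite NE.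
(* The block of the rows and columns other than the first, then row [0], then
   column [0]. *)
pose ra (k : 'I_n) : nat := if k == 0 then n else k.
pose cb (k : 'I_n) : nat := if k == 0 then (N * N)%N else k.
have ra_inj : injective ra.
  move=> x y; rewrite /ra; case: eqP => [->|_]; case: eqP => [->|_] // e.
  - by have := ltnN y; rewrite -e ltnn.
  - by have := ltnN x; rewrite e ltnn.
  exact: val_inj.
have cb_inj : injective cb.
  move=> x y; rewrite /cb; case: eqP => [->|_]; case: eqP => [->|_] // e.
  - by have := ltnN y; lia.
  - by have := ltnN x; lia.
  exact: val_inj.
have raN k : (ra k < N)%N by rewrite /ra; case: ifP => _; have := ltnN k; lia.
have cbN k : (cb k < N \/ cb k = N * N)%N.
  by rewrite /cb; case: ifP => _; [right | left; have := ltnN k; lia].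
have w1_inj := lex_weight_inj ra_inj cb_inj raN cbN.
have lead1P := lex_leadP ra_inj cb_inj raN cbN T.
have lead1lP := lex_lead_lastP ra_inj cb_inj raN cbN T.
pose w1 i j := (N * ra i + cb j)%N.
(* The same block in the same order, then column [0], then row [0]. *)
pose a2 (k : 'I_n) : nat := if k == 0 then (2 * (N * N))%N else (N * k)%N.
pose w2 i j := (a2 i + cb j)%N.
have w2_inj i j i' j' : (a2 i + cb j = a2 i' + cb j')%N -> i = i' /\ j = j'.
  have := mulN i; have := mulN i'; have := ltnN i; have := ltnN i'.
  have := ltnN j; have := ltnN j'; rewrite /a2 /cb => lj' lj li' li Ni' Ni.
  have [ei|ni] := eqVneq i 0; have [ei'|ni'] := eqVneq i' 0 => e.
  - split; first by rewrite ei ei'.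
    by move: e => /addnI; case: eqP => [->|_]; case: eqP => [->|_] e; try lia; exact: val_inj.
  - by exfalso; move: e; case: (j == 0); case: (j' == 0) => e; lia.
  - by exfalso; move: e; case: (j == 0); case: (j' == 0) => e; lia.
  have [ej|nj] := eqVneq j 0; have [ej'|nj'] := eqVneq j' 0.
  - rewrite ej ej' eqxx in e *; move/addIn/eqP: e; rewrite eqn_pmul2l // => /eqP e.
    by split=> //; exact: val_inj.
  - by exfalso; move: e; rewrite ej (negbTE nj') eqxx => e; lia.
  - by exfalso; move: e; rewrite ej' (negbTE nj) eqxx => e; lia.
  move: e; rewrite (negbTE nj) (negbTE nj') => e.
  have [| | | | |e1 e2] := @lex_weight_eq N i j i' j';
    [lia|lia|left; lia|left; lia|assumption|by split; apply: val_inj].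
have block i j : i != 0 -> j != 0 -> lead w1 T i j <-> lead w2 T i j.
  move=> i0 j0; have eq_lt i' j' : (w1 i' j' < w1 i j)%N = (w2 i' j' < w2 i j)%N.
    rewrite /w1 /w2 /ra /cb /a2 (negbTE i0) (negbTE j0).
    have := mulN i; have := mulN i'; have := ltnN j; have := ltnN j'.
    by case: (i' == 0); case: (j' == 0) => *; lia.
  split=> [/(leadP w1_inj)|/(leadP w2_inj)] [t [tT tij t0]].
    by apply/(leadP w2_inj); exists t; split=> // i' j'; rewrite -eq_lt; exact: t0.
  by apply/(leadP w1_inj); exists t; split=> // i' j' lt; apply: t0; rewrite -eq_lt.
have cb0 : cb 0 = (N * N)%N by rewrite /cb eqxx.
have cbE k : k != 0 -> cb k = k by rewrite /cb => /negbTE->.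
have cb_lt k : k != 0 -> (cb k < N)%N by move=> k0; rewrite cbE //; have := ltnN k; lia.
have no_lead1 i : i != 0 -> ~ lead w1 T i 0.
  by move=> i0 /(lead1lP _ _ cb0)[t [tT + t0 _]]; rewrite (colT t) ?eqxx.
have lt2_row0 (i' j' j : 'I_n) : i' != 0 -> (w2 i' j' < w2 0%R j)%N.
  move=> i'0; rewrite /w2 /a2 /cb eqxx (negbTE i'0); have := mulN i'; have := ltnN j'.
  by case: (j' == 0); case: (j == 0) => *; lia.
have no_lead2 j : j != 0 -> ~ lead w2 T 0 j.
  move=> j0 /(leadP w2_inj)[t [tT + t0]]; rewrite (rowT t) ?eqxx // => i' j' i'0.
  exact/t0/lt2_row0.
(* A column full for [w1] is incompatible with the full line of [w2], since the
   leads inside the block are the same for both weights. *)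
have [full1 extra1] : (forall j, lead w1 T 0 j) /\
    forall k l k' l', lead w1 T k l -> lead w1 T k' l' ->
      k != 0 -> k' != 0 -> k = k' /\ l = l'.
  have [[i [full extra]]|[j [full1 extra1]]] := leads_fill_line n_gt3 goodT w1_inj.
    by have [e|/no_lead1[]] := eqVneq i 0; [rewrite e in full extra | exact: full].
  have [e|j0] := eqVneq j 0; first by case: (@no_lead1 i1) => //; rewrite -e.
  have lead2 i (i0 : i != 0) : lead w2 T i j := (block i j i0 j0).1 (full1 i).
  exfalso; have [[i [full2 extra2]]|[l [full2 extra2]]] := leads_fill_line n_gt3 goodT w2_inj.
    have [x [y [xy x0 xi y0 yi]]] := two_others 0 i.
    by have [e _] := extra2 _ _ _ _ (lead2 x x0) (lead2 y y0) xi yi; rewrite e eqxx in xy.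
  have [e|l0] := eqVneq l 0; last by case: (no_lead2 l).
  rewrite e in extra2.
  by have [] := extra2 _ _ _ _ (lead2 i1 isT) (lead2 i2 isT) j0 j0.
have full2 i : lead w2 T i 0.
  have [[k [full2 _]]|[l [full2 extra2]]] := leads_fill_line n_gt3 goodT w2_inj.
    have [e|k0] := eqVneq k 0; first by case: (@no_lead2 i1) => //; rewrite -e.
    have lead1 j (j0 : j != 0) : lead w1 T k j := (block k j k0 j0).2 (full2 j).
    by have [_] := extra1 _ _ _ _ (lead1 i1 isT) (lead1 i2 isT) k0 k0.
  by have [<- //|l0] := eqVneq l 0; case: (no_lead2 l).
have [_ _ [J JT uJ]] := goodT.
have [r [c [rE c0 Jrc]]] := @two_rows_off_column K m J i1 i2 0 uJ isT.
have r0 : r != 0 by case/orP: rE => /eqP->.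
have [t [tT t0c t0]] : exists t, [/\ t \in T, t 0 c != 0 &
    forall i j, i != 0 -> j != 0 -> t i j = 0].
  have [t [tT tnz t0]] := (lead1P _ _ (cb_lt c c0)).1 (full1 c); exists t; split=> // i j i0 j0.
  by apply: t0; [exact: cb_lt | left; rewrite /ra eqxx (negbTE i0)].
have col0 (k : 'I_n) : k != 0 -> exists s, [/\ s \in T, s k 0 != 0,
    forall i j, i != 0 -> j != 0 -> s i j = 0 &
    forall i : 'I_n, i != 0 -> (i < k)%N -> s i 0 = 0].
  move=> k0; have /(leadP w2_inj)[s [sT snz s0]] := full2 k.
  exists s; split=> // [i j i0 j0|i i0 ik]; apply: s0.
    rewrite /w2 /a2 cb0 (negbTE i0) (negbTE k0) cbE //.
    have hi := mulN i; have hj := ltnN j; clear -hi hj NN nN; lia.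
  by rewrite ltn_add2r /a2 (negbTE i0) (negbTE k0) ltn_pmul2l.
have [s1 [s1T s1nz s1b _]] := col0 i1 isT.
have [s2 [s2T s2nz s2b s20]] := col0 i2 isT.
(* Among two elements with different leads in column [0], a combination vanishes at
   [(0, c)]. *)
have [s [k [sT sk sb s0c k0]]] : exists s (k : 'I_n), [/\ s \in T, s k 0 != 0,
    forall i j, i != 0 -> j != 0 -> s i j = 0, s 0 c = 0 & k != 0].
  have [s10|s1c] := eqVneq (s1 0 c) 0; first by exists s1, i1.
  have [s20c|s2c] := eqVneq (s2 0 c) 0; first by exists s2, i2.
  exists (s2 - (s2 0 c / s1 0 c) *: s1), i1; split=> //.
  - by rewrite rpredB // memvZ.
  - by rewrite !mxE s20 // sub0r oppr_eq0 !mulf_neq0 ?invr_eq0.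
  - by move=> i j hi hj; rewrite !mxE (s1b i j) ?(s2b i j) // mulr0 subr0.
  by rewrite !mxE divfK ?subrr.
(* Column [c] comes first, then column [0]; row [0] is the last row. *)
pose cc (j : 'I_n) : nat := if j == c then 0 else if j == 0 then 1 else j.+1.
pose b3 (j : 'I_n) : nat := (N * cc j)%N.
pose w3 i j := (ra i + b3 j)%N.
have cc_inj : injective cc.
  move=> x y; rewrite /cc; have [->|_] := eqVneq x c.
    by have [->|_] := eqVneq y c => //; case: ifP.
  have [->|x0] := eqVneq x 0.
    case: ifP => // _; have [->//|y0 [e]] := eqVneq y 0.
    by case/eqP: y0; apply: val_inj.
  case: ifP => // _; have [->|_ [e]] := eqVneq y 0; last exact: val_inj.
  by move=> [e]; case/eqP: x0; apply: val_inj.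
have ccN j : (cc j < N)%N.
  by rewrite /cc; case: ifP => // _; case: ifP => // _; have hj := ltnN j; clear -hj nN; lia.
have w3_inj i j i' j' : (ra i + b3 j = ra i' + b3 j')%N -> i = i' /\ j = j'.
  rewrite addnC [RHS]addnC => /lex_weight_eq[//|//|||]; try by left.
  by move=> /cc_inj-> /ra_inj->.
have w3_first (i' j' : 'I_n) x : (x < N)%N -> (ra i' + b3 j' <= x)%N -> j' = c /\ (ra i' <= x)%N.
  rewrite /b3 => xN le; have [e|j'c] := eqVneq j' c.
    by split=> //; apply: leq_trans le; exact: leq_addr.
  have : (0 < cc j')%N by rewrite /cc (negbTE j'c); case: ifP.
  move/(leq_mul (leqnn N)); rewrite muln1 => le1; clear -le1 le xN; lia.
have w3c i : (ra i + b3 c = ra i)%N by rewrite /b3 /cc eqxx muln0 addn0.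
have ra_lt i : i != 0 -> (ra i < n)%N by rewrite /ra => /negbTE->.
have ra_lt0 i : (ra i < n)%N -> i != 0 by apply: contraTneq => ->; rewrite /ra eqxx ltnn.
have [i' [lead_i' i'0]] : exists i', lead w3 T i' c /\ i' != 0.
  have [i' [j' [lead' _]]] := lead_ex w3_inj JT Jrc.
  rewrite w3c => /w3_first[|jc le]; first exact: raN.
  by exists i'; rewrite -jc; split=> //; apply/ra_lt0/(leq_ltn_trans le)/ra_lt.
have lead0c : lead w3 T 0 c.
  apply/(leadP w3_inj); exists t; split=> // i j; rewrite w3c => lt.
  have [|-> _] := w3_first i j _ (raN 0); first exact: ltnW.
  apply: t0 => //; apply/ra_lt0/(leq_ltn_trans _ (_ : ra i + b3 j < n)%N); first exact: leq_addr.
  by rewrite (leq_trans lt) // /ra eqxx.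
have lead00 : lead w3 T 0 0.
  apply/(leadP w3_inj); exists (delta_mx 0 0); split=> // [|i j].
    by rewrite mxE !eqxx oner_eq0.
  rewrite mxE; case: (i =P 0) => [->|//]; case: (j =P 0) => [->|//].
  by rewrite ltnn.
have [k' [lead_k' k'0]] : exists k', lead w3 T k' 0 /\ k' != 0.
  have [x [y [lead' sxy]]] := lead_ex w3_inj sT sk.
  have yc : y != c.
    apply: contraNneq sxy => ->; have [->|x0] := eqVneq x 0; first by rewrite s0c.
    by rewrite sb.
  rewrite /b3 /cc (negbTE yc) [0 == c]eq_sym (negbTE c0) eqxx muln1.
  have rakn := ra_lt k k0; have [y0 le|y0 le] := eqVneq y 0.
    exists x; rewrite -{1}y0; split=> //; apply: ra_lt0; clear -le rakn nN; lia.
  have le2 : (N * 2 <= N * y.+1)%N by rewrite leq_mul // ltnS lt0n.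
  by clear -le le2 rakn nN; lia.
have [[x [_ extra]]|[y [_ extra]]] := leads_fill_line n_gt3 goodT w3_inj.
  have [x0|x0] := eqVneq x 0.
    rewrite x0 in extra; have [_ e] := extra _ _ _ _ lead_i' lead_k' i'0 k'0.
    by rewrite e eqxx in c0.
  rewrite eq_sym in x0; have [_ e] := extra _ _ _ _ lead0c lead00 x0 x0.
  by rewrite e eqxx in c0.
have [y0|y0] := eqVneq y 0.
  rewrite y0 in extra; have [e _] := extra _ _ _ _ lead_i' lead0c c0 c0.
  by rewrite e eqxx in i'0.
rewrite eq_sym in y0; have [e _] := extra _ _ _ _ lead_k' lead00 y0 y0.
by rewrite e eqxx in k'0.
Qed.

Lemma good_space_delta T : good_space T -> delta_mx 0 0 \in T ->
  contains_rank_one_space T.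
Proof.
move=> goodT dT.
have nz k : (delta_mx 0 0 : 'rV[K]_k.+1) != 0.
  by apply/eqP => /rowP/(_ 0)/eqP; rewrite !mxE !eqxx oner_eq0.
have [all_y|colT] := column_part goodT dT; first by right; exists (delta_mx 0 0).
have dT' : delta_mx 0 0 \in tr_space T by rewrite mem_tr_space trmx_delta.
have [all_y|rowT] := column_part (good_tr_space goodT) dT'.
  by apply: contains_tr_space; right; exists (delta_mx 0 0).
exfalso; apply: (delta_in_space_absurd goodT dT colT) => t tT t0 j j0.
have := rowT t^T; rewrite mem_tr_space trmxK => /(_ tT _ j j0); rewrite !mxE; apply.
by move=> i k k0; rewrite mxE t0.
Qed.

(** After an equivalence, [T] contains the identity, hence a matrix of rank one;
    after another one, it contains [delta_mx 0 0]. *)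
Lemma good_space_contains T : good_space T -> contains_rank_one_space T.
Proof.
move=> goodT; have [_ _ [J JT uJ]] := goodT.
have uV : invmx J \in unitmx by rewrite unitmx_inv.
apply: (contains_mul_space uV (unitmx1 _ n)); set T' := mul_space _ _ _.
have goodT' : good_space T' by exact: good_mul_space (unitmx1 _ _) goodT.
have T'1 : 1%:M \in T'.
  by rewrite mem_mul_spaceE ?unitmx1 // invmxK invmx1 !mulmx1.
have [t tT rk] := good_space_rank_one_id goodT' T'1.
have uC : invmx (col_ebase t) \in unitmx by rewrite unitmx_inv col_ebase_unit.
have uR : invmx (row_ebase t) \in unitmx by rewrite unitmx_inv row_ebase_unit.
apply: (contains_mul_space uC uR); apply: good_space_delta; first exact: good_mul_space.
rewrite mem_mul_spaceE // !invmxK.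
have -> : delta_mx 0 0 = pid_mx 1 :> 'M[K]_n.
  apply/matrixP => i j; rewrite !mxE -!val_eqE /= ltnS leqn0.
  by case: (i : nat) (j : nat) => [|?] [|?]; rewrite ?andbF.
by have := mulmx_ebase t; rewrite rk => ->.
Qed.

End CrossCase.

(** * Spaces of singular matrices of order three *)

(** The element [e] witnesses that the field has more than two elements. *)
Section OrderThree.

Variables (K : fieldType) (e : K).
Hypotheses (e0 : e != 0) (e1 : e != 1).
Implicit Types (V : {vspace 'M[K]_3}) (v M N X J P Q : 'M[K]_3).

Local Notation E i j := (delta_mx i j : 'M[K]_3).

(** [V] is a space of singular matrices of dimension at least five that is
    annihilated by some regular matrix. *)
Definition singular_space V : Prop :=
  [/\ (4 < \dim V)%N, forall v, v \in V -> \det v = 0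
    & exists2 J, J \in unitmx & forall v, v \in V -> mxdot v J = 0].

(** All elements of [V] have a common non-zero column in their kernel, or a common
    non-zero row in their left kernel. *)
Definition common_kernel V : Prop :=
  (exists2 y : 'cV[K]_3, y != 0 & forall v, v \in V -> v *m y = 0) \/
  (exists2 p : 'rV[K]_3, p != 0 & forall v, v \in V -> p *m v = 0).

Let avoid2 (a b : K) : exists s, (s != a) && (s != b).
Proof.
have [a0|a0] := eqVneq 0 a; have [b0|b0] := eqVneq 0 b.
- by exists 1; rewrite -a0 -b0 oner_eq0.
- have [b1|b1] := eqVneq 1 b; last by exists 1; rewrite -a0 oner_eq0.
  by exists e; rewrite -a0 -b1 e0.
- have [a1|a1] := eqVneq 1 a; last by exists 1; rewrite -b0 oner_eq0 a1.
  by exists e; rewrite -a1 -b0 e1.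
by exists 0; rewrite a0 b0.
Qed.

Lemma singular_mul_space P Q V : P \in unitmx -> Q \in unitmx ->
  singular_space V -> singular_space (mul_space P Q V).
Proof.
move=> uP uQ [dV sV [J uJ JV]]; split.
- rewrite /mul_space limg_dim_eq //; apply/eqP; rewrite -subv0; apply/subvP => v.
  rewrite memv_cap memv_ker lfunE /= memv0 => /andP[_ /eqP/(congr1 (mulmx^~ (invmx Q)))].
  by rewrite mul0mx mulmxK // => /(congr1 (mulmx (invmx P))); rewrite mulKmx // mulmx0 => ->.
- move=> v; rewrite mem_mul_spaceE // => /sV det0.
  have -> : v = P *m (invmx P *m v *m invmx Q) *m Q.
    by rewrite !mulmxA mulmxKV // mulmxV // mul1mx.
  by rewrite det_mulmx det_mulmx det0 mulr0 mul0r.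
exists (invmx P^T *m J *m invmx Q^T); first by rewrite !unitmx_mul !unitmx_inv !unitmx_tr uP uQ uJ.
move=> v; rewrite mem_mul_spaceE // => /JV <-.
rewrite mxdot_mul; congr mxdot.
by rewrite !trmx_inv !trmxK.
Qed.

Lemma common_kernel_mul_space P Q V : P \in unitmx -> Q \in unitmx ->
  common_kernel (mul_space P Q V) -> common_kernel V.
Proof.
move=> uP uQ [[y y0 yV]|[p p0 pV]].
  left; exists (Q *m y) => [|v vV].
    by apply: contra y0 => /eqP/(canRL (mulKmx uQ)); rewrite mulmx0 => ->.
  have := yV (P *m v *m Q); rewrite mem_mul_space // => /(_ vV).
  by rewrite -!mulmxA => /(canRL (mulKmx uP)); rewrite mulmx0.
right; exists (p *m P) => [|v vV].
  by apply: contra p0 => /eqP/(canRL (mulmxK uP)); rewrite mul0mx => ->.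
have := pV (P *m v *m Q); rewrite mem_mul_space // => /(_ vV).
by rewrite !mulmxA => /(canRL (mulmxK uQ)); rewrite mul0mx.
Qed.

Lemma mem_of_dim V (s : seq 'M[K]_3) : (size s <= \dim V)%N ->
  (forall v, v \in V -> v \in <<s>>%VS) -> forall v, v \in s -> v \in V.
Proof.
move=> sz sub v vs; have /eqP -> : V == <<s>>%VS.
  rewrite eqEdim (leq_trans (dim_span s)) // andbT.
  by apply/subvP.
exact: memv_span.
Qed.

Lemma zero_entry_dec V i j :
  (forall v, v \in V -> v i j = 0) \/ (exists2 v, v \in V & v i j != 0).
Proof.
pose f := linfun (mulmxr (delta_mx j 0 : 'cV[K]_3) \o mulmx (delta_mx 0 i : 'rV[K]_3)).
have fE v : (v \in lker f) = (v i j == 0).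
  rewrite memv_ker lfunE /= -rowE -colE; apply/eqP/eqP => [/matrixP/(_ 0 0)|vij].
    by rewrite !mxE.
  by apply/matrixP => k l; rewrite !ord1 !mxE.
have [/subvP sub|/subvPn[v vV]] := boolP (V <= lker f)%VS.
  by left=> v /sub; rewrite fE => /eqP.
by rewrite fE => ?; right; exists v.
Qed.

Lemma rank_gt1 v (i j k l : 'I_3) :
  v i j * v k l - v i l * v k j != 0 -> (1 < \rank v)%N.
Proof.
pose f (x y : 'I_3) (z : 'I_2) := if z == ord0 then x else y.
pose B : 'M[K]_2 := mxsub (f i k) (f j l) v; move=> nz.
have uB : B \in unitmx by rewrite unitmxE unitfE det2E !mxE.
suff : (\rank B <= \rank v)%N by rewrite mxrank_unit.
rewrite /B mxsubrc; apply: leq_trans (mxrankS (rowsub_sub _ _)) _.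
rewrite -mxrank_tr -[X in (_ <= X)%N]mxrank_tr.
by have -> : (colsub (f j l) v)^T = rowsub (f j l) v^T; [apply/matrixP => x y; rewrite !mxE | exact: mxrankS (rowsub_sub _ _)].
Qed.

Let span5 (s1 s2 s3 s4 s5 : 'M[K]_3) a1 a2 a3 a4 a5 :
  a1 *: s1 + a2 *: s2 + a3 *: s3 + a4 *: s4 + a5 *: s5
    \in <<[:: s1; s2; s3; s4; s5]>>%VS.
Proof. by rewrite !rpredD // memvZ // memv_span // !inE eqxx ?orbT. Qed.

(** A space of matrices of rank at most one that contains an elementary matrix lies
    in the span of a row and a column, and by its dimension it is all of it; but this
    span contains a matrix of rank two. *)
Lemma exists_rank_two V : singular_space V -> exists2 A, A \in V & \rank A = 2.
Proof.
move=> sV; suff [A AV rk] : exists2 A, A \in V & (1 < \rank A)%N.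
  have [_ detV _] := sV; exists A => //; apply/eqP; rewrite eqn_leq rk andbT.
  rewrite -ltnS ltn_neqAle rank_leq_row andbT.
  apply/negP => full; have : A \in unitmx by rewrite -row_free_unit.
  by rewrite unitmxE detV // unitr0.
have [dV _ _] := sV; pose A := vpick V.
have A0 : A != 0 by rewrite vpick0 -dimv_eq0 -lt0n (leq_trans _ dV).
have [rk|rk] := ltnP 1 (\rank A); first by exists A; rewrite ?memv_pick.
have rkA : \rank A = 1 by apply/eqP; rewrite eqn_leq rk lt0n mxrank_eq0.
have uP : invmx (col_ebase A) \in unitmx by rewrite unitmx_inv col_ebase_unit.
have uQ : invmx (row_ebase A) \in unitmx by rewrite unitmx_inv row_ebase_unit.
set P := invmx _ in uP; set Q := invmx _ in uQ.
have [dV' _ _] := singular_mul_space uP uQ sV; set V' := mul_space P Q V in dV'.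
suff [v vV' rkv] : exists2 v, v \in V' & (1 < \rank v)%N.
  exists (invmx P *m v *m invmx Q); first by rewrite -mem_mul_spaceE.
  have fullP : row_full (invmx P) by rewrite row_full_unit unitmx_inv.
  have freeQ : row_free (invmx Q) by rewrite row_free_unit unitmx_inv.
  by rewrite (mxrankMfree _ freeQ) (eqmxMfull _ fullP).
have EV' : E i30 i30 \in V'.
  rewrite mem_mul_spaceE // !invmxK.
  have -> : E i30 i30 = pid_mx 1 by apply: mx3P; split; rewrite !mxE.
  by have := mulmx_ebase A; rewrite rkA => ->; exact: memv_pick.
pose cross := [:: E i30 i30; E i30 i31; E i30 i32; E i31 i30; E i32 i30].
have [/subvP sub|/subvPn[v vV' vN]] := boolP (V' <= <<cross>>)%VS.
  have crossV := @mem_of_dim V' cross dV' sub.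
  exists (E i30 i31 + E i31 i30); first by rewrite rpredD ?crossV ?inE ?eqxx ?orbT.
  by apply: (@rank_gt1 _ i30 i31 i31 i30); rewrite !mxE /= !addr0 !add0r mulr1 mul0r subr0 oner_eq0.
have [i [j [i0 j0 vij]]] : exists i j, [/\ i != i30, j != i30 & v i j != 0].
  case: (pickP (fun p : 'I_3 * 'I_3 => [&& p.1 != i30, p.2 != i30 & v p.1 p.2 != 0])) => [[i j] /and3P[*]|none].
    by exists i, j.
  have v0 i j : i != i30 -> j != i30 -> v i j = 0.
    by move=> hi hj; have := none (i, j); rewrite /= hi hj => /eqP.
  case/negP: vN; rewrite /cross.
  have -> : v = v i30 i30 *: E i30 i30 + v i30 i31 *: E i30 i31 + v i30 i32 *: E i30 i32
              + v i31 i30 *: E i31 i30 + v i32 i30 *: E i32 i30; last exact: span5.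
  have z i j (hi : i != i30) (hj : j != i30) := v0 i j hi hj.
  apply: mx3P; split; rewrite !mxE /= ?(z i31 i31 isT isT) ?(z i31 i32 isT isT);
    by rewrite ?(z i32 i31 isT isT) ?(z i32 i32 isT isT); ring.
have [minor0|minor] := eqVneq (v i30 i30 * v i j - v i30 j * v i i30) 0; last first.
  by exists v; rewrite // (rank_gt1 minor).
exists (E i30 i30 + v); first by rewrite rpredD.
apply: (@rank_gt1 _ i30 i30 i j); rewrite !mxE (negbTE i0) (negbTE j0) /= !add0r.
by rewrite mulrDl mul1r -addrA minor0 addr0.
Qed.

(** The determinant of [s *: pid_mx 2 + v] is a quadratic polynomial in [s] without
    constant term that vanishes at [1] and [e]; its coefficients are thus zero. *)
Lemma idempotent_in_space V v : singular_space V -> pid_mx 2 \in V -> v \in V ->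
  v i32 i32 = 0 /\ v i32 i30 * v i30 i32 + v i32 i31 * v i31 i32 = 0.
Proof.
move=> [_ detV _] AV vV.
pose q := v i32 i30 * v i30 i32 + v i32 i31 * v i31 i32.
pose c := v i32 i32 * (v i30 i30 + v i31 i31) - q.
have det_sA s : \det (s *: pid_mx 2 + v) = s ^+ 2 * v i32 i32 + s * c + \det v.
  by rewrite /c /q !det3E !mxE /=; ring.
have eqn s : s ^+ 2 * v i32 i32 + s * c = 0.
  have d0 : \det (s *: pid_mx 2 + v) = 0 by apply: detV; rewrite rpredD // memvZ.
  by rewrite -d0 det_sA (detV v vV) addr0.
have v0 : v i32 i32 = 0.
  have c1 := eqn 1; have ce := eqn e; apply/eqP.
  have : e * (e - 1) * v i32 i32 = 0.
    rewrite [LHS](_ : _ = (e ^+ 2 * v i32 i32 + e * c) - e * (1 ^+ 2 * v i32 i32 + 1 * c)).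
      by rewrite ce c1 mulr0 subrr.
    by ring.
  by move/eqP; rewrite !mulf_eq0 subr_eq0 (negbTE e0) (negbTE e1).
split=> //; have := eqn 1; rewrite /c v0; move/eqP.
by rewrite mulr0 add0r mul1r mul0r sub0r oppr_eq0 => /eqP.
Qed.

(** The conditions of [idempotent_in_space] on all sums of elements of [V] force
    either [V] to have dimension at most three, or [V] to be the space of all
    matrices that vanish on a square of side two. In the latter case every matrix
    that annihilates [V] has a zero row. *)
Lemma normal_position_absurd V M : singular_space V -> pid_mx 2 \in V -> M \in V ->
  [/\ M i30 i32 = 1, M i31 i32 = 0, M i32 i30 = 0 & M i32 i31 = 1] -> False.
Proof.
move=> sV AV MV [M02 M12 M20 M21]; have [dV detV [J uJ JV]] := sV.
have key v (vV : v \in V) := idempotent_in_space sV AV vV.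
have polar v : v \in V -> v i32 i30 + v i31 i32 = 0.
  move=> vV; have [_ qv] := key v vV.
  have [_] := key (M + v) (rpredD MV vV); rewrite !mxE M02 M12 M20 M21 => qMv.
  rewrite [LHS](_ : _ = ((0 + v i32 i30) * (1 + v i30 i32)
      + (1 + v i32 i31) * (0 + v i31 i32))
    - (v i32 i30 * v i30 i32 + v i32 i31 * v i31 i32)); last by ring.
  by rewrite qMv qv subrr.
have M22 : M i32 i32 = 0 by have [] := key M MV.
have M10 : M i31 i30 = 0.
  by have := detV M MV; rewrite det3E M02 M12 M20 M21 M22 => <-; ring.
have [all0|[N0 N0V nz]] := zero_entry_dec V i32 i30.
  have V12 v : v \in V -> v i31 i32 = 0.
    by move=> vV; have := polar v vV; rewrite all0 // add0r.
  have V22 v : v \in V -> v i32 i32 = 0 by move=> vV; have [] := key v vV.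
  (* The determinant of [v + s *: M] is a product of three factors up to sign, two of
     which do not vanish for some [s]. *)
  have V10 v : v \in V -> v i31 i30 = 0.
    move=> vV; have [s /andP[s1 s2]] := avoid2 (- v i30 i32) (- v i32 i31).
    have := detV _ (rpredD vV (memvZ s MV)).
    rewrite det3E !mxE all0 // V12 // V22 // M02 M12 M20 M21 M22 M10.
    rewrite !(mulr0, mulr1, addr0, mul0r, subr0, sub0r, oppr0, add0r) => /eqP.
    by rewrite !mulf_eq0 ![_ + s]addrC !addr_eq0 (negbTE s1) (negbTE s2) orbF => /eqP.
  pose U := [:: E i30 i30; E i30 i31; E i30 i32; E i31 i31; E i32 i31].
  have UV : forall v, v \in U -> v \in V.
    apply: mem_of_dim => // v vV.
    have -> : v = v i30 i30 *: E i30 i30 + v i30 i31 *: E i30 i31 + v i30 i32 *: E i30 i32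
                + v i31 i31 *: E i31 i31 + v i32 i31 *: E i32 i31; last exact: span5.
    apply: mx3P; split; rewrite !mxE /= ?(V10 v vV) ?(V12 v vV) ?(V22 v vV);
      by rewrite ?(all0 v vV); ring.
  have J0 j : J i30 j = 0.
    rewrite -mxdot_delta mxdotC; apply/JV/UV; case: (ord3P j) => ->; by rewrite !inE eqxx ?orbT.
  by move: uJ; rewrite unitmxE unitfE det3E !J0 !mul0r subrr addr0 eqxx.
pose N := (N0 i32 i30)^-1 *: (N0 - N0 i32 i31 *: M).
have NV : N \in V by rewrite memvZ // rpredB // memvZ.
have N20 : N i32 i30 = 1 by rewrite !mxE M20 mulr0 subr0 mulVf.
have N21 : N i32 i31 = 0 by rewrite !mxE M21 mulr1 subrr mulr0.
clearbody N; have N12 : N i31 i32 = -1.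
  by have := polar N NV; rewrite N20 addrC => /eqP; rewrite addr_eq0 => /eqP.
have [N22 qN] := key N NV.
have N02 : N i30 i32 = 0 by move: qN; rewrite N20 N21 mul1r mul0r addr0.
have N01 : N i30 i31 = 0.
  apply: oppr_inj; rewrite oppr0 -(detV N NV) det3E N20 N21 N12 N22 N02; ring.
have VMNA v : v \in V -> v \in <<[:: M; N; pid_mx 2]>>%VS.
  move=> vV; have [v22 qv] := key v vV; have pv := polar v vV.
  have v02 : v i30 i32 = v i32 i31.
    have [_] := key (N + v) (rpredD NV vV); rewrite !mxE N20 N21 N12 N02 => qNv.
    apply/eqP; rewrite -subr_eq0; apply/eqP.
    rewrite [LHS](_ : _ = ((1 + v i32 i30) * (0 + v i30 i32) + (0 + v i32 i31) * (-1 + v i31 i32))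
      - (v i32 i30 * v i30 i32 + v i32 i31 * v i31 i32)); last by ring.
    by rewrite qNv qv subrr.
  pose X := v - v i32 i31 *: M - v i32 i30 *: N.
  have XE : X = v - v i32 i31 *: M - v i32 i30 *: N by [].
  have XV : X \in V by rewrite !rpredB // memvZ.
  have X02 : X i30 i32 = 0 by rewrite !mxE M02 N02 v02; ring.
  have X12 : X i31 i32 = 0.
    by rewrite -[RHS]pv !mxE M12 N12; ring.
  have X20 : X i32 i30 = 0 by rewrite !mxE M20 N20; ring.
  have X21 : X i32 i31 = 0 by rewrite !mxE M21 N21; ring.
  clearbody X; have [X22 _] := key X XV.
  have X10 : X i31 i30 = 0.
    have := detV _ (rpredD MV XV).
    rewrite det3E; rewrite ![(M + X) _ _]mxE M02 M12 M20 M21 M22 M10 X02 X12 X20 X21 X22 => <-; ring.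
  have X01 : X i30 i31 = 0.
    apply: oppr_inj; rewrite oppr0 -(detV _ (rpredD NV XV)) det3E ![(N + X) _ _]mxE.
    rewrite N02 N12 N20 N21 N22 N01 X02 X12 X20 X21 X22; ring.
  have X00 : X i30 i30 = X i31 i31.
    have MNX := rpredD (rpredD MV NV) XV.
    have detMN := detV _ (rpredD MV NV).
    apply/eqP; rewrite -subr_eq0; apply/eqP; rewrite -[RHS](subrr 0) -{1}(detV _ MNX) -detMN.
    rewrite !det3E ![(M + N + X) _ _]mxE ![(M + N) _ _]mxE.
    rewrite M02 M12 M20 M21 M22 M10 N02 N12 N20 N21 N22 N01 X01 X10 X02 X12 X20 X21 X22; ring.
  have -> : v = v i32 i31 *: M + v i32 i30 *: N + X i30 i30 *: pid_mx 2.
    rewrite -[LHS](subrK (v i32 i31 *: M + v i32 i30 *: N)) [LHS]addrC; congr (_ + _).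
    have -> : v - (v i32 i31 *: M + v i32 i30 *: N) = X by rewrite XE opprD addrA.
    by apply: mx3P; split; rewrite [RHS]mxE [X in _ * X]mxE /= ?X01 ?X02 ?X10 ?X12 ?X20 ?X21 ?X22 ?X00; ring.
  by rewrite !rpredD // memvZ // memv_span // !inE eqxx ?orbT.
have : (\dim V <= 3)%N.
  by apply: leq_trans (dim_span [:: M; N; pid_mx 2]); apply: dimvS; apply/subvP.
by rewrite leqNgt (leq_trans _ dV).
Qed.

(** Over a field with more than two elements, a space of singular matrices of
    order three and dimension at least five that some regular matrix annihilates
    has a common kernel or a common left kernel. *)
Lemma singular_space_kernel V : singular_space V -> common_kernel V.
Proof.
move=> sV0; have [A0 A0V rkA] := exists_rank_two sV0.
have uP0 : invmx (col_ebase A0) \in unitmx by rewrite unitmx_inv col_ebase_unit.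
have uQ0 : invmx (row_ebase A0) \in unitmx by rewrite unitmx_inv row_ebase_unit.
apply: (common_kernel_mul_space uP0 uQ0).
have sV := singular_mul_space uP0 uQ0 sV0.
have AV : pid_mx 2 \in mul_space (invmx (col_ebase A0)) (invmx (row_ebase A0)) V.
  by rewrite mem_mul_spaceE // !invmxK; have := mulmx_ebase A0; rewrite rkA => ->.
move: {V sV0 A0 A0V rkA uP0 uQ0} (mul_space _ _ _) sV AV => V sV AV.
have key v (vV : v \in V) := idempotent_in_space sV AV vV.
have [B0|[M1 M1V M1nz]] : (forall v, v \in V -> v i30 i32 = 0 /\ v i31 i32 = 0) \/
    exists2 v, v \in V & (v i30 i32 != 0) || (v i31 i32 != 0).
- have [V0|[v vV nz]] := zero_entry_dec V i30 i32; last by right; exists v; rewrite ?nz.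
  have [V1|[v vV nz]] := zero_entry_dec V i31 i32; last by right; exists v; rewrite ?nz ?orbT.
  by left=> v vV; rewrite V0 ?V1.
- left; exists (delta_mx i32 0).
    by apply/eqP => /colP/(_ i32)/eqP; rewrite !mxE !eqxx oner_eq0.
  move=> v vV; rewrite -colE; apply/colP => i; rewrite !mxE.
  have [v0 v1] := B0 v vV; have [v2 _] := key v vV.
  by case: (ord3P i) => ->.
have [C0|[M2 M2V M2nz]] : (forall v, v \in V -> v i32 i30 = 0 /\ v i32 i31 = 0) \/
    exists2 v, v \in V & (v i32 i30 != 0) || (v i32 i31 != 0).
- have [V0|[v vV nz]] := zero_entry_dec V i32 i30; last by right; exists v; rewrite ?nz.
  have [V1|[v vV nz]] := zero_entry_dec V i32 i31; last by right; exists v; rewrite ?nz ?orbT.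
  by left=> v vV; rewrite V0 ?V1.
- right; exists (delta_mx 0 i32).
    by apply/eqP => /rowP/(_ i32)/eqP; rewrite !mxE !eqxx oner_eq0.
  move=> v vV; rewrite -rowE; apply/rowP => i; rewrite !mxE.
  have [v0 v1] := C0 v vV; have [v2 _] := key v vV.
  by case: (ord3P i) => ->.
exfalso.
have [M [MV Bnz Cnz]] : exists M, [/\ M \in V, (M i30 i32 != 0) || (M i31 i32 != 0)
    & (M i32 i30 != 0) || (M i32 i31 != 0)].
  have [C1|] := boolP ((M1 i32 i30 != 0) || (M1 i32 i31 != 0)); first by exists M1.
  have [B2|] := boolP ((M2 i30 i32 != 0) || (M2 i31 i32 != 0)); first by exists M2.
  rewrite !negb_or !negbK => /andP[/eqP B20 /eqP B21] /andP[/eqP C10 /eqP C11].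
  by exists (M1 + M2); rewrite rpredD // !mxE B20 B21 C10 C11 !addr0 !add0r.
have [M22 qM] := key M MV.
set b0 := M i30 i32 in Bnz qM; set b1 := M i31 i32 in Bnz qM.
set c0 := M i32 i30 in Cnz qM; set c1 := M i32 i31 in Cnz qM.
have [x [y xy]] : exists x y, x * b0 + y * b1 = 1.
  have [b00|nb0] := eqVneq b0 0; last by exists b0^-1, 0; rewrite mul0r addr0 mulVf.
  by exists 0, b1^-1; rewrite mul0r add0r mulVf //; move: Bnz; rewrite b00 eqxx.
(* The conjugation by [P] fixes [pid_mx 2] and brings the last column and the last
   row of [M] to elementary vectors. *)
pose P : 'M[K]_3 := \matrix_(i, j)
  nth 0 (nth [::] [:: [:: x; y; 0]; [:: c0; c1; 0]; [:: 0; 0; 1]] i) j.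
have uP : P \in unitmx.
  rewrite unitmxE unitfE det3E !mxE /=.
  have -> : x * (c1 * 1 - 0 * 0) - y * (c0 * 1 - 0 * 0) + 0 * (c0 * 0 - c1 * 0) = x * c1 - y * c0 by ring.
  apply: contraTneq Cnz => d0.
  have -> : c0 = 0.
    rewrite -[c0]mulr1 -xy; have -> : c0 * (x * b0 + y * b1) = x * (c0 * b0 + c1 * b1) - b1 * (x * c1 - y * c0) by ring.
    by rewrite qM d0 !mulr0 subrr.
  have -> : c1 = 0.
    rewrite -[c1]mulr1 -xy; have -> : c1 * (x * b0 + y * b1) = y * (c0 * b0 + c1 * b1) + b0 * (x * c1 - y * c0) by ring.
    by rewrite qM d0 !mulr0 addr0.
  by rewrite eqxx.
have uQ : invmx P \in unitmx by rewrite unitmx_inv.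
pose M' := P *m M *m invmx P.
have PA : P *m pid_mx 2 = pid_mx 2 *m P.
  by apply: mx3P; split; rewrite !mxE !sum3E !mxE /=; ring.
apply: (@normal_position_absurd (mul_space P (invmx P) V) M').
- exact: singular_mul_space.
- by rewrite -(mulmxK uP (pid_mx 2)) -PA mem_mul_space.
- by rewrite mem_mul_space.
have col2 i : M' i i32 = (P *m M) i i32.
  have -> : M' i i32 = (M' *m delta_mx i32 (0 : 'I_1)) i 0 by rewrite -colE [RHS]mxE.
  have Pe : P *m delta_mx i32 (0 : 'I_1) = delta_mx i32 0.
    by rewrite -colE; apply/colP => k; rewrite !mxE; case: (ord3P k) => ->.
  by rewrite /M' -(mulmxA (P *m M)) -{1}Pe mulKmx // -colE [LHS]mxE.
have row2 j : M' i32 j = (delta_mx (0 : 'I_1) i31 : 'rV[K]_3) 0 j.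
  have -> : M' i32 j = (delta_mx (0 : 'I_1) i32 *m M') 0 j by rewrite -rowE [RHS]mxE.
  have Pe : delta_mx (0 : 'I_1) i32 *m P *m M = delta_mx 0 i31 *m P.
    rewrite -!rowE; apply/rowP => k; rewrite !mxE sum3E !mxE /=.
    by case: (ord3P k) => -> /=; rewrite -/c0 -/c1 ?M22; ring.
  by rewrite /M' !mulmxA Pe mulmxK.
split; rewrite ?row2 ?col2 !mxE ?sum3E ?mxE //= -/b0 -/b1 ?M22 mulr0 addr0 //.
Qed.

End OrderThree.

Section Annihilator.

Variables (K : fieldType) (n : nat) (T : {vspace 'M[K]_n}).

(** The pairings of [v] with a basis of [T]. *)
Definition pair_basis (v : 'M[K]_n) : 'rV[K]_(\dim T) :=
  \row_i mxdot v (vbasis T)`_i.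

Fact pair_basis_is_linear : linear pair_basis.
Proof.
move=> a x y; apply/rowP => i.
by rewrite !mxE ![mxdot _ (vbasis T)`_i]mxdotC mxdotDr mxdotZr.
Qed.
HB.instance Definition _ := GRing.isLinear.Build K 'M[K]_n 'rV[K]_(\dim T) _
  pair_basis pair_basis_is_linear.

(** The matrices annihilated by [T] for the entrywise pairing. *)
Definition annihilator : {vspace 'M[K]_n} := lker (linfun pair_basis).

Lemma mem_annihilator v :
  reflect (forall t, t \in T -> mxdot v t = 0) (v \in annihilator).
Proof.
rewrite memv_ker lfunE /=; apply: (iffP eqP) => [/rowP v0 t tT|v0].
  rewrite (coord_vbasis tT) mxdotC mxdot_suml big1 // => i _.
  by have := v0 i; rewrite !mxE => vi; rewrite mxdotC mxdotZr vi mulr0.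
by apply/rowP => i; rewrite !mxE v0 // vbasis_mem // mem_nth // size_tuple.
Qed.

Lemma dim_annihilator : (n * n <= \dim annihilator + \dim T)%N.
Proof.
have := limg_ker_dim (linfun pair_basis) fullv.
rewrite capfv dimvf dim_matrix => e.
apply: (@leq_trans (\dim annihilator + \dim (limg (linfun pair_basis)))); first by rewrite e.
rewrite leq_add2l; apply: leq_trans (dimvS (subvf _)) _; by rewrite dimvf dim_matrix mul1r.
Qed.

End Annihilator.

Lemma good_space3_contains (K : fieldType) (e : K) (T : {vspace 'M[K]_3}) :
  e != 0 -> e != 1 -> good_space T -> contains_rank_one_space T.
Proof.
move=> e0 e1 [dT sT [J JT uJ]].
have sV : singular_space (annihilator T).
  split; first by have := dim_annihilator T; lia.
    move=> v /mem_annihilator/sT; rewrite unitmxE unitfE negbK => /eqP //.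
  by exists J => // v /mem_annihilator; apply.
have [[y y0 yV]|[p p0 pV]] := singular_space_kernel e0 e1 sV.
  right; exists y^T; first by rewrite trmx_eq0.
  move=> x; apply: mem_double_annihilator => v /mem_annihilator/yV vy.
  by rewrite /mxdot mulmxA mxtrace_mulC mulmxA -trmx_mul vy trmx0 mul0mx mxtrace0.
left; exists p^T; first by rewrite trmx_eq0.
move=> x; apply: mem_double_annihilator => v /mem_annihilator/pV pv.
by rewrite /mxdot mulmxA -trmx_mul pv trmx0 mul0mx mxtrace0.
Qed.

(** * From rank-one spaces to the standard form *)

Section Assembly.

Variables (K : fieldType) (n : nat).
Hypothesis n_gt2 : (2 < n)%N.
Implicit Types (B M L : 'M[K]_n) (y z : 'cV[K]_n) (p q : 'rV[K]_n).

Lemma scalar_rank_le2 (c : K) y z p q : c%:M = y *m p + z *m q -> c = 0.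
Proof.
move=> e; apply/eqP; apply: contraLR n_gt2 => c0; rewrite -leqNgt.
have <- : \rank (c%:M : 'M[K]_n) = n.
  by rewrite mxrank_unit // unitmxE det_scalar unitrX // unitfE.
rewrite e (leq_trans (mxrank_add _ _)) //.
by rewrite (leq_add (n1 := 1) (n2 := 1)) // (leq_trans (mxrankM_maxl _ _)) // rank_leq_col.
Qed.

Lemma mul_cV_rV_eq0 y p : y *m p = 0 -> y != 0 -> p = 0.
Proof.
move=> yp0 y0; apply/rowP => j; rewrite mxE; apply/eqP; apply: contraNT y0 => pj.
apply/eqP/colP => i; have := congr1 (fun A : 'M_n => A i j) yp0.
by rewrite !mxE big_ord1 => /eqP; rewrite mulf_eq0 (negbTE pj) orbF => /eqP.
Qed.

Lemma mul_cV_rV_indep y z p q : y != 0 -> (forall a, z != a *: y) ->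
  y *m p + z *m q = 0 -> p = 0 /\ q = 0.
Proof.
move=> y0 indep e; have q0 : q = 0.
  apply/rowP => j; rewrite mxE; apply/eqP; apply: contraT => qj.
  case/eqP: (indep (- (p 0 j / q 0 j))); apply/colP => i.
  have := congr1 (fun A : 'M_n => A i j) e; rewrite !mxE !big_ord1.
  move/eqP; rewrite addrC addr_eq0 => /eqP h.
  by rewrite -[LHS](mulfK qj) h; field.
by split=> //; apply: mul_cV_rV_eq0 y0; rewrite -[RHS]e q0 mulmx0 addr0.
Qed.

Variable G : {linear 'M[K]_n -> 'M[K]_n}.
Hypotheses (G_inj : injective G) (G1 : G 1%:M = 1%:M).

Let G_scalar c : G c%:M = c%:M.
Proof. by rewrite -scalemx1 linearZ /= G1. Qed.

(** The vectors [q] and the scalars [c] may be chosen linearly in [p]. *)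
Lemma linear_choice y z :
  (forall p, exists q c, G (y *m p) = z *m q + c%:M) ->
  exists L (k : 'cV[K]_n), forall p, G (y *m p) = z *m (p *m L) + ((p *m k) 0 0)%:M.
Proof.
move=> yz; have /fin_all_exists[f fP] (i : 'I_n) : exists u : 'rV[K]_n * K,
    G (y *m delta_mx 0 i) = z *m u.1 + u.2%:M.
  by have [q [c e]] := yz (delta_mx 0 i); exists (q, c).
exists (\matrix_i (f i).1), (\col_i (f i).2) => p.
rewrite {1}[p]row_sum_delta mulmx_sumr linear_sum /=.
under eq_bigr => i _ do rewrite -scalemxAr linearZ /= fP scalerDr.
rewrite big_split /=; congr (_ + _).
  rewrite mulmx_sum_row mulmx_sumr; apply: eq_bigr => i _.
  by rewrite rowK scalemxAr.
rewrite mxE raddf_sum /=; apply: eq_bigr => i _.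
by rewrite !mxE scale_scalar_mx.
Qed.

(** The values of [G] on the matrices with image in the line of [y] lie, up to
    scalar matrices, among those with image in a line depending on [y]. *)
Hypothesis G_lines : forall y, y != 0 -> exists2 z, z != 0 &
  forall p, exists q c, G (y *m p) = z *m q + c%:M.

(** The linear map of the previous choice is injective, because [G] is. *)
Let choice_inj y z L (k : 'cV[K]_n) : y != 0 ->
  (forall p, G (y *m p) = z *m (p *m L) + ((p *m k) 0 0)%:M) -> L \in unitmx.
Proof.
move=> y0 GE; rewrite -row_free_unit -kermx_eq0; apply/rowV0P => p /sub_kermxP pL0.
have /G_inj e : G (y *m p) = G ((p *m k) 0 0)%:M by rewrite GE pL0 mulmx0 add0r G_scalar.
apply: mul_cV_rV_eq0 (y0); rewrite e.
by rewrite (@scalar_rank_le2 ((p *m k) 0 0) y 0 p 0) ?mul0mx ?addr0 // raddf0.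
Qed.

(** Let [z i] and [L i] describe [G] on the line of the [i]-th basis vector. The value
    of [G] on the line of [E o + E i] shows that [L i] is a multiple of [L o], so that
    [G B = H *m B *m L o] modulo scalar matrices, and the value at the identity gives
    [H]. *)
Lemma adjoint_form : exists L (c : K) (mu : 'M[K]_n -> K),
  [/\ L \in unitmx, c != 0 & forall B, G B = c *: (invmx L *m B *m L) + (mu B)%:M].
Proof.
have n_gt0 : (0 < n)%N by apply: leq_trans n_gt2.
pose o : 'I_n := Ordinal n_gt0; pose E i : 'cV[K]_n := delta_mx i 0.
have E0 i : E i != 0.
  by apply/eqP => /colP/(_ i)/eqP; rewrite !mxE !eqxx oner_eq0.
have ex i : exists u : 'cV[K]_n * 'M[K]_n * 'cV[K]_n, u.1.1 != 0 /\
    forall p, G (E i *m p) = u.1.1 *m (p *m u.1.2) + ((p *m u.2) 0 0)%:M.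
  have [z z0 /linear_choice[L [k Lk]]] := G_lines (E0 i).
  by exists (z, L, k).
have {ex} /fin_all_exists[u uP] := ex.
pose z i := (u i).1.1; pose L i := (u i).1.2; pose k i := (u i).2.
have z0 i : z i != 0 by have [] := uP i.
have GE i p : G (E i *m p) = z i *m (p *m L i) + ((p *m k i) 0 0)%:M by have [_] := uP i.
have uL i : L i \in unitmx by exact: choice_inj (E0 i) (GE i).
have z_indep i a : i != o -> z i != a *: z o.
  move=> io; apply/eqP => zi.
  pose p : 'rV[K]_n := delta_mx 0 o; pose r := a *: (p *m L i *m invmx (L o)).
  have e : G (E i *m p - E o *m r) = G ((p *m k i) 0 0 - (r *m k o) 0 0)%:M.
    rewrite linearB /= !GE G_scalar zi /r -!scalemxAl mulmxKV // -scalemxAr.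
    by rewrite raddfB /= opprD addrACA subrr add0r.
  have {e} e := G_inj e.
  have c0 : (p *m k i) 0 0 - (r *m k o) 0 0 = 0.
    by apply: (@scalar_rank_le2 _ (E i) (E o) p (- r)); rewrite -e mulmxN.
  have := congr1 (fun A : 'M_n => A i o) e; rewrite c0 raddf0 !mxE !big_ord1 !mxE !eqxx.
  by rewrite (negbTE io) mul1r mul0r subr0 => /eqP; rewrite oner_eq0.
have prop i : exists rho, forall p, p *m L i = rho *: (p *m L o).
  have [->|io] := eqVneq i o; first by exists 1 => p; rewrite scale1r.
  have y0 : E o + E i != 0.
    apply/eqP => /colP/(_ o)/eqP; rewrite !mxE !eqxx [o == i]eq_sym (negbTE io) addr0.
    by rewrite oner_eq0.
  have [x x0 /linear_choice[L' [k' GE']]] := G_lines y0.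
  pose ka := k' - k o - k i.
  have eq p : x *m (p *m L') + ((p *m ka) 0 0)%:M = z o *m (p *m L o) + z i *m (p *m L i).
    have : G ((E o + E i) *m p) = G (E o *m p) + G (E i *m p) by rewrite mulmxDl linearD.
    rewrite GE' !GE /ka !mulmxBr => e.
    have -> : (p *m k' - p *m k o - p *m k i) 0 0 =
              (p *m k') 0 0 - (p *m k o) 0 0 - (p *m k i) 0 0 by rewrite !mxE.
    rewrite !raddfB /= !addrA e -addrA -opprD; apply/eqP; rewrite subr_eq; apply/eqP.
    by rewrite addrACA.
  (* For a [p] in the kernel of [ka] there is no scalar term, which puts [x] in the
     span of [z o] and [z i]. *)
  clearbody ka; have [al [be xE]] : exists al be, x = al *: z o + be *: z i.
    have [p p0 pka] : exists2 p : 'rV[K]_n, p != 0 & p *m ka = 0.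
      have : kermx ka != 0.
        rewrite kermx_eq0 /row_free; apply: contraTneq n_gt2 => rk.
        by rewrite -leqNgt -rk (leq_trans (rank_leq_col _)).
      by case/rowV0Pn => p /sub_kermxP pk pn0; exists p.
    have := eq p; rewrite pka mxE raddf0 addr0 => e.
    have a0 : p *m L o != 0.
      by apply: contra p0 => /eqP pL; rewrite -(mulmxK (uL o) p) pL mul0mx.
    have [j aj] : exists j, (p *m L o) 0 j != 0.
      apply/existsP; apply: contraNT a0; rewrite negb_exists => /forallP a0.
      by apply/eqP/rowP => j; rewrite [RHS]mxE; apply/eqP; have := a0 j; rewrite negbK.
    set d := (p *m L') 0 j; set a := (p *m L o) 0 j in aj; set b := (p *m L i) 0 j.
    have ej : d *: x = a *: z o + b *: z i.
      apply/colP => l; have := congr1 (fun A : 'M_n => A l j) e; rewrite !mxE !big_ord1.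
      by rewrite -/a -/b -/d ![_ * x _ _]mulrC ![_ * z _ _ _]mulrC.
    have d0 : d != 0.
      apply: contraNneq (z_indep i (- (a / b)) io) => d0.
      have /eqP := ej; rewrite d0 scale0r eq_sym addrC addr_eq0 => /eqP bz.
      have b0 : b != 0.
        apply: contraNneq (z0 o) => b0; move/eqP: bz; rewrite b0 scale0r eq_sym oppr_eq0.
        by rewrite scaler_eq0 (negbTE aj).
      by apply/eqP; rewrite -[LHS](scalerK b0) bz scalerN scalerA -scaleNr mulrC.
    exists (d^-1 * a), (d^-1 * b).
    by rewrite -!scalerA -scalerDr -ej scalerK.
  have split_eq p : al *: (p *m L') = p *m L o /\ be *: (p *m L') = p *m L i.
    have := eq p; rewrite {1}xE mulmxDl => e.
    have ka0 : (p *m ka) 0 0 = 0.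
      apply: (@scalar_rank_le2 _ (z o) (z i) (p *m L o - al *: (p *m L')) (p *m L i - be *: (p *m L'))).
      rewrite !mulmxBr -!scalemxAr !scalemxAl addrACA -e -opprD.
      by rewrite [RHS]addrAC subrr add0r.
    move: e; rewrite ka0 raddf0 addr0 => /eqP; rewrite -subr_eq0 opprD addrACA => /eqP e.
    have [||] := @mul_cV_rV_indep (z o) (z i) (al *: (p *m L') - p *m L o) (be *: (p *m L') - p *m L i) (z0 o).
    - by move=> a; apply: z_indep.
    - by rewrite !mulmxBr -!scalemxAr !scalemxAl.
    by move=> /eqP + /eqP; rewrite !subr_eq0 => /eqP-> /eqP->.
  have al0 : al != 0.
    pose p : 'rV[K]_n := delta_mx 0 o; apply: contraTneq (uL o) => al0.
    have pL : p *m L o = 0 by have [<- _] := split_eq p; rewrite al0 scale0r.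
    apply/negP => uLo; have /eqP := mulmxK uLo p.
    rewrite pL mul0mx eq_sym => /eqP/rowP/(_ o)/eqP; by rewrite !mxE !eqxx oner_eq0.
  exists (be / al) => p; have [<- <-] := split_eq p.
  by rewrite scalerA divfK.
have /fin_all_exists[rho rhoP] := prop.
pose H : 'M[K]_n := \matrix_(l, i) (rho i * z i l 0).
pose mu B := \sum_i (row i B *m k i) 0 0.
have GB B : G B = H *m B *m L o + (mu B)%:M.
  have {1}-> : B = \sum_i E i *m row i B.
    apply/matrixP => a b; rewrite summxE (bigD1 a) //= big1 ?addr0.
      by rewrite !mxE big_ord1 !mxE !eqxx mul1r.
    by move=> i ia; rewrite !mxE big_ord1 !mxE eq_sym (negbTE ia) mul0r.
  rewrite linear_sum /=; under eq_bigr => i _ do rewrite GE.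
  rewrite big_split /= raddf_sum; congr (_ + _).
  rewrite -mulmxA [RHS](_ : _ = \sum_i col i H *m row i (B *m L o)); last first.
    apply/matrixP => a b; rewrite summxE mxE; apply: eq_bigr => i _.
    by rewrite !mxE big_ord1 !mxE.
  apply: eq_bigr => i _; rewrite rhoP -scalemxAr scalemxAl row_mul; congr (_ *m _).
  by apply/colP => l; rewrite !mxE.
set c := 1 - mu 1%:M.
have HL : H *m L o = c%:M.
  have e := GB 1%:M; rewrite G1 mulmx1 in e.
  by rewrite raddfB /= {1}e addrK.
have HE : H = c *: invmx (L o).
  by rewrite -[LHS](mulmxK (uL o)) HL mul_scalar_mx.
exists (L o), c, mu; split=> // [|B]; last by rewrite GB HE -!scalemxAl.
apply/eqP => c0; have /G_inj e : G (E o *m delta_mx 0 o) = G (mu (E o *m delta_mx 0 o))%:M.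
  by rewrite GB HE c0 scale0r !mul0mx add0r G_scalar.
have mu0 : mu (E o *m delta_mx 0 o) = 0.
  by apply: (@scalar_rank_le2 _ (E o) 0 (delta_mx 0 o) 0); rewrite -e mul0mx addr0.
have := mul_cV_rV_eq0 (etrans e _) (E0 o); rewrite mu0 raddf0 => /(_ erefl).
by move=> /rowP/(_ o)/eqP; rewrite !mxE !eqxx oner_eq0.
Qed.

End Assembly.

Section Adjoint.

Variables (K : fieldType) (n : nat) (F : {linear 'M[K]_n -> 'M[K]_n}).

(** The adjoint of [F] for the entrywise pairing. *)
Definition adjoint_mx (B : 'M[K]_n) : 'M[K]_n :=
  \matrix_(i, j) mxdot (F (delta_mx i j)) B.

Fact adjoint_mx_is_linear : linear adjoint_mx.
Proof. by move=> a x y; apply/matrixP => i j; rewrite !mxE mxdotDr mxdotZr. Qed.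
HB.instance Definition _ := GRing.isLinear.Build K 'M[K]_n 'M[K]_n _
  adjoint_mx adjoint_mx_is_linear.

Lemma mxdot_adjoint M B : mxdot (F M) B = mxdot M (adjoint_mx B).
Proof.
rewrite mxdotE [in LHS](matrix_sum_delta M) linear_sum mxdotE.
have -> : \sum_i \sum_j (\sum_k F (\sum_l M k l *: delta_mx k l)) i j * B i j
    = mxdot (\sum_k F (\sum_l M k l *: delta_mx k l)) B by rewrite mxdotE.
rewrite mxdot_suml; apply: eq_bigr => k _; rewrite linear_sum mxdot_suml.
by apply: eq_bigr => l _; rewrite linearZ /= mxdotC mxdotZr mxdotC mxE.
Qed.

Hypothesis sl_F : sl_preserver F.

Let Ftr M : \tr (F M) = \tr M. Proof. by case: sl_F. Qed.

Lemma mxdot1r (M : 'M[K]_n) : mxdot M 1%:M = \tr M.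
Proof. by rewrite /mxdot mulmx1 mxtrace_tr. Qed.

Lemma mxdot_inj (A B : 'M[K]_n) : (forall v, mxdot v A = mxdot v B) -> A = B.
Proof.
by move=> AB; apply/matrixP => i j; rewrite -!mxdot_delta mxdotC AB mxdotC.
Qed.

Lemma adjoint1 : adjoint_mx 1%:M = 1%:M.
Proof. by apply: mxdot_inj => v; rewrite -mxdot_adjoint !mxdot1r Ftr. Qed.

Lemma adjoint_inj : injective adjoint_mx.
Proof.
have [_ F_inj _] := sl_F.
have F_surj v : exists M, F M = v.
  have ker0 : lker (linfun F) == 0%VS.
    by apply/lker0P => x y; rewrite !lfunE => /F_inj.
  by exists ((linfun F)^-1%VF v); rewrite -[RHS](lker0_lfunVK ker0) lfunE.
move=> A B AB; apply: mxdot_inj => v; have [M <-] := F_surj v.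
by rewrite !mxdot_adjoint AB.
Qed.

(** The image under the adjoint of the matrices with image in the line of [y],
    together with the scalar matrices. *)
Definition line_space (y : 'cV[K]_n) : {vspace 'M[K]_n} :=
  (limg (linfun (adjoint_mx \o mulmx y : 'rV[K]_n -> 'M[K]_n)) + <[1%:M]>)%VS.

Lemma mem_line_space y t :
  reflect (exists p c, t = adjoint_mx (y *m p) + c%:M) (t \in line_space y).
Proof.
apply: (iffP memv_addP) => [[u /memv_imgP[p _ ->]] [v /vlineP[c ->] ->]|[p [c ->]]].
  by exists p, c; rewrite lfunE /= scalemx1.
exists (adjoint_mx (y *m p)).
  by apply/memv_imgP; exists p; rewrite ?memvf // lfunE.
by exists c%:M => //; rewrite -(scalemx1 _ c) memvZ // memv_line.
Qed.

Lemma dim_line_space y : (\dim (line_space y) <= n.+1)%N.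
Proof.
apply: leq_trans (dimv_add_leqif _ _) _; set f := linfun _.
have d1 : (\dim (limg f) <= n)%N.
  have := limg_ker_dim f fullv; rewrite [X in _ = X]dimvf dim_matrix mul1r => e.
  by rewrite -[X in (_ <= X)%N]e leq_addl.
have d2 : (\dim <[1%:M : 'M[K]_n]>%VS <= 1)%N by rewrite dim_vline leq_b1.
by apply: leq_trans (leq_add d1 d2) _; rewrite addn1.
Qed.

Lemma good_line_space y : y != 0 -> good_space (line_space y).
Proof.
move=> y0; have [_ _ F_unit] := sl_F; split; first exact: dim_line_space.
  move=> v vT; apply/negP => uv.
  have trv : \tr v = 0.
    rewrite -mxdot1r; apply: vT; apply/mem_line_space; exists 0, 1.
    by rewrite mulmx0 linear0 add0r.
  have uF := F_unit v trv uv; case/eqP: y0.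
  apply: (can_inj (mulKmx (_ : (F v)^T \in unitmx))); first by rewrite unitmx_tr.
  rewrite mulmx0; apply/colP => i; rewrite [RHS]mxE.
  have : mxdot (F v) (y *m delta_mx 0 i) = 0.
    rewrite mxdot_adjoint; apply: vT; apply/mem_line_space.
    by exists (delta_mx 0 i), 0; rewrite raddf0 addr0.
  by rewrite /mxdot mulmxA mxtrace_mulC -rowE /mxtrace big_ord1 mxE.
exists 1%:M; last exact: unitmx1.
by apply/mem_line_space; exists 0, 1; rewrite mulmx0 linear0 add0r.
Qed.

Hypothesis n_gt2 : (2 < n)%N.

(** A subspace of [line_space y] of dimension [n] without scalar matrices spans it
    together with the identity. *)
Let line_eq (U : {vspace 'M[K]_n}) y : (\dim U = n)%N -> 1%:M \notin U ->
  (U <= line_space y)%VS -> line_space y = (U + <[1%:M]>)%VS.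
Proof.
move=> dU U1 sub.
have dUl : \dim (U + <[1%:M]>)%VS = n.+1.
  rewrite dimv_disjoint_sum ?dU ?dim_vline.
    have -> : (1%:M : 'M[K]_n) != 0 by apply: contraNneq U1 => ->; exact: mem0v.
    by rewrite addn1.
  apply/eqP; rewrite -subv0; apply/subvP => v; rewrite memv_cap => /andP[vU /vlineP[k vk]].
  rewrite memv0 vk; have [->|k0] := eqVneq k 0; first by rewrite scale0r.
  by case/negP: U1; rewrite -[1%:M](scalerK k0) -vk memvZ.
apply/eqP; rewrite eq_sym eqEdim subv_add sub -memvE dUl dim_line_space andbT.
by apply/mem_line_space; exists 0, 1; rewrite mulmx0 linear0 add0r.
Qed.

Let one_not_rank1 (z : 'cV[K]_n) p : 1%:M != z *m p.
Proof.
apply/eqP => e; have e' : (1 : K)%:M = z *m p + 0 *m p by rewrite mul0mx addr0.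
by have /eqP := scalar_rank_le2 n_gt2 e'; rewrite oner_eq0.
Qed.

Lemma line_space_image (y z : 'cV[K]_n) : z != 0 -> (forall p, z *m p \in line_space y) ->
  forall p, exists q c, adjoint_mx (y *m p) = z *m q + c%:M.
Proof.
move=> z0 zT p; set f := linfun (mulmx z : 'rV[K]_n -> 'M[K]_n).
have eqT : line_space y = (limg f + <[1%:M]>)%VS.
  apply: line_eq.
  - have /eqP k0 : lker f == 0%VS.
      apply/lker0P => a b; rewrite !lfunE /= => /eqP; rewrite -subr_eq0 -mulmxBr => /eqP.
      by move/mul_cV_rV_eq0/(_ z0)/eqP; rewrite subr_eq0 => /eqP.
    by rewrite limg_dim_eq ?k0 ?capv0 // dimvf dim_matrix mul1r.
  - apply/memv_imgP => -[q _]; rewrite lfunE /= => /eqP; exact/negP/one_not_rank1.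
  by apply/subvP => t /memv_imgP[q _ ->]; rewrite lfunE; exact: zT.
have : adjoint_mx (y *m p) \in line_space y.
  by apply/mem_line_space; exists p, 0; rewrite raddf0 addr0.
rewrite eqT => /memv_addP[u /memv_imgP[q _ ->] [v /vlineP[c ->] ->]].
by exists q, c; rewrite lfunE scalemx1.
Qed.

Lemma line_space_kernel (y : 'cV[K]_n) (q : 'rV[K]_n) : q != 0 -> (forall z, z *m q \in line_space y) ->
  forall p, exists z c, adjoint_mx (y *m p) = z *m q + c%:M.
Proof.
move=> q0 zT p; set f := linfun (mulmxr q : 'cV[K]_n -> 'M[K]_n).
have eqT : line_space y = (limg f + <[1%:M]>)%VS.
  apply: line_eq.
  - have /eqP k0 : lker f == 0%VS.
      apply/lker0P => a b; rewrite !lfunE /= => /eqP; rewrite -subr_eq0 -mulmxBl => /eqP e.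
      apply/eqP; rewrite -subr_eq0; apply/eqP/trmx_inj; rewrite trmx0.
      apply: (@mul_cV_rV_eq0 _ _ q^T); last by rewrite trmx_eq0.
      by rewrite -trmx_mul e trmx0.
    by rewrite limg_dim_eq ?k0 ?capv0 // dimvf dim_matrix mulr1.
  - apply/memv_imgP => -[z _]; rewrite lfunE /= => /eqP; exact/negP/one_not_rank1.
  by apply/subvP => t /memv_imgP[z _ ->]; rewrite lfunE; exact: zT.
have : adjoint_mx (y *m p) \in line_space y.
  by apply/mem_line_space; exists p, 0; rewrite raddf0 addr0.
rewrite eqT => /memv_addP[u /memv_imgP[z _ ->] [v /vlineP[c ->] ->]].
by exists z, c; rewrite lfunE scalemx1.
Qed.

(** Two line spaces attached to different lines share no matrix of rank one. *)
Lemma line_space_meet (y y' z : 'cV[K]_n) q : y != 0 -> (forall a, y' != a *: y) ->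
  z != 0 -> q != 0 -> z *m q \in line_space y -> z *m q \notin line_space y'.
Proof.
move=> y0 indep z0 q0 /mem_line_space[p [c e]]; apply/mem_line_space => -[p' [c' e']].
have Gs a : adjoint_mx a%:M = a%:M by rewrite -scalemx1 linearZ /= adjoint1.
have /adjoint_inj e2 : adjoint_mx (y *m p - y' *m p') = adjoint_mx (c' - c)%:M.
  rewrite linearB /= Gs raddfB /=; apply/eqP; rewrite subr_eq addrAC [_ + adjoint_mx _]addrC.
  by rewrite -e' e addrK.
have c0 : c' - c = 0 by apply: (@scalar_rank_le2 _ _ n_gt2 _ y y' p (- p')); rewrite -e2 mulmxN.
have [|p0 _] := @mul_cV_rV_indep _ _ y y' p (- p') y0 indep.
  by rewrite mulmxN e2 c0 raddf0.
move: e; rewrite p0 mulmx0 linear0 add0r => e.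
have cc : c = 0 by apply: (@scalar_rank_le2 _ _ n_gt2 _ z 0 q 0); rewrite -e mul0mx addr0.
by case/eqP: q0; apply: mul_cV_rV_eq0 z0; rewrite e cc raddf0.
Qed.

Hypothesis contains : forall T : {vspace 'M[K]_n},
  good_space T -> contains_rank_one_space T.

(** The alternative for one column decides it for all columns; the function [t] below
    is the identity or the transposition accordingly. *)
Lemma sl_preserver_standard : standard_on_sl F.
Proof.
have finish (t : {linear 'M[K]_n -> 'M[K]_n}) :
    (forall M B, mxdot (t M) (t B) = mxdot M B) -> t 1%:M = 1%:M -> injective t ->
    (forall y : 'cV[K]_n, y != 0 -> exists2 z : 'cV[K]_n, z != 0 &
       forall p : 'rV[K]_n, exists (q : 'rV[K]_n) c, t (adjoint_mx (y *m p)) = z *m q + c%:M) ->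
    exists (P : 'M[K]_n) (lambda : K), [/\ P \in unitmx, lambda != 0 &
      forall M, \tr M = 0 -> F M = lambda *: (P *m t M *m invmx P)].
  move=> t_dot t1 t_inj lines.
  pose G : {linear 'M[K]_n -> 'M[K]_n} := t \o adjoint_mx.
  have [|||L [c [mu [uL c0 GE]]]] := @adjoint_form K n n_gt2 G.
  - by move=> A B /t_inj/adjoint_inj.
  - by rewrite /= adjoint1.
  - exact: lines.
  exists (invmx L)^T, c; split=> //; first by rewrite unitmx_tr unitmx_inv.
  move=> M trM; apply: mxdot_inj => B; rewrite mxdotC mxdot_adjoint -t_dot.
  rewrite -[t (adjoint_mx B)]/(G B) GE mxdotDr mxdotZr -scalemx1 mxdotZr -t1 t_dot mxdot1r trM mulr0 addr0.
  by rewrite mxdotZr mxdot_mul -trmx_inv invmxK !trmxK; congr (_ * _); exact: mxdotC.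
have n_gt0 : (0 < n)%N by apply: leq_trans n_gt2.
pose o : 'I_n := Ordinal n_gt0; pose y0 : 'cV[K]_n := delta_mx o 0.
have y0nz : y0 != 0 by apply/eqP => /colP/(_ o)/eqP; rewrite !mxE !eqxx oner_eq0.
have colinear (y : 'cV[K]_n) : {a | y = a *: y0} + {forall a, y != a *: y0}.
  have [/eqP e|ne] := boolP (y == y o 0 *: y0); first by left; exists (y o 0).
  right=> a; apply: contra ne => /eqP e; rewrite {2}e !mxE !eqxx mulr1; exact/eqP.
have [[z0 z0nz z0T]|[q0 q0nz q0T]] := contains (good_line_space y0nz).
- have [|P [lambda [uP l0 PE]]] :=
    finish idfun (fun _ _ => erefl) erefl (@inj_id _); last first.
    by exists P, lambda; split=> //; left.
  move=> y ynz /=; have [[a ya]|indep] := colinear y.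
    exists z0 => // p; have [q [c e]] := line_space_image z0nz z0T (a *: p).
    by exists q, c; rewrite -e ya -scalemxAl scalemxAr.
  have [[z znz zT]|[q qnz qT]] := contains (good_line_space ynz).
    by exists z => //; apply: line_space_image.
  by case/negP: (line_space_meet y0nz indep z0nz qnz (z0T q)).
have [|P [lambda [uP l0 PE]]] :=
  finish trmx (@mxdot_tr _ _) (trmx1 _ _) (@trmx_inj _ _ _); last first.
  by exists P, lambda; split=> //; right.
move=> y ynz /=; have [[a ya]|indep] := colinear y.
  exists q0^T; first by rewrite trmx_eq0.
  move=> p; have [z [c e]] := line_space_kernel q0nz q0T (a *: p).
  exists z^T, c; rewrite -trmx_mul -[c%:M]tr_scalar_mx -linearD /= -e.
  by rewrite ya -scalemxAl scalemxAr.
have [[z znz zT]|[q qnz qT]] := contains (good_line_space ynz).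
  by case/negP: (line_space_meet y0nz indep znz q0nz (q0T z)).
exists q^T; first by rewrite trmx_eq0.
move=> p; have [z [c e]] := line_space_kernel qnz qT p.
by exists z^T, c; rewrite e linearD /= trmx_mul tr_scalar_mx.
Qed.

End Adjoint.

(** * Order two *)

Section OrderTwo.

Variable K : fieldType.

(** The matrix with rows [a b] and [c -a]. *)
Definition sl2 (a b c : K) : 'M[K]_2 :=
  \matrix_(i, j) if i == ord0 then (if j == ord0 then a else b)
                 else (if j == ord0 then c else - a).

Lemma mx2P (A B : 'M[K]_2) : A ord0 ord0 = B ord0 ord0 ->
  A ord0 ord_max = B ord0 ord_max -> A ord_max ord0 = B ord_max ord0 ->
  A ord_max ord_max = B ord_max ord_max -> A = B.
Proof.
have oP (i : 'I_2) : i = ord0 \/ i = ord_max.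
  by case: i => [[|[|//]] ?]; [left | right]; apply: val_inj.
by move=> *; apply/matrixP => i j; case: (oP i) => ->; case: (oP j) => ->.
Qed.

Lemma tr2E (A : 'M[K]_2) : \tr A = A ord0 ord0 + A ord_max ord_max.
Proof.
rewrite /mxtrace !big_ord_recl big_ord0 addr0; congr (_ + A _ _); exact: val_inj.
Qed.

Lemma sl2E (A : 'M[K]_2) : \tr A = 0 ->
  A = sl2 (A ord0 ord0) (A ord0 ord_max) (A ord_max ord0).
Proof.
rewrite tr2E => /eqP; rewrite addrC addr_eq0 => /eqP e.
by apply: mx2P; rewrite !mxE.
Qed.

Lemma det_sl2 a b c : \det (sl2 a b c) = - (a ^+ 2 + b * c).
Proof. by rewrite det2E !mxE /=; ring. Qed.

Lemma sl2_lin k a b c a' b' c' :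
  k *: sl2 a b c + sl2 a' b' c' = sl2 (k * a + a') (k * b + b') (k * c + c').
Proof. by apply: mx2P; rewrite !mxE /= ?mulrN ?opprD. Qed.

(** The quadratic polynomial in [t] has too many roots to be non-zero, unless the
    field has two or three elements; then the coefficients are found by inspection. *)
Lemma quadratic_conditions (p q r b : K) : p != 0 -> b != 0 ->
  (forall t, t != 0 -> r + t * (p ^+ 2 - b + q * r) - t ^+ 2 * (q * b) = 0) ->
  [/\ q = 0, r = 0 & b = p ^+ 2].
Proof.
move=> p0 b0; set A := p ^+ 2 - b + q * r => h.
have h1 := h 1 (oner_neq0 K); rewrite expr1n !mul1r in h1.
have hN1 : r - A - q * b = 0.
  by rewrite -[RHS](h (-1)) ?oppr_eq0 ?oner_eq0 // sqrrN expr1n !mul1r mulN1r.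
have conclude : r = 0 -> q * b = 0 -> A = 0 -> [/\ q = 0, r = 0 & b = p ^+ 2].
  move=> r0 /eqP; rewrite mulf_eq0 (negbTE b0) orbF => /eqP q0; rewrite /A q0 mul0r addr0.
  by move/eqP; rewrite subr_eq0 => /eqP ->.
have even_odd : (1 + 1) * r = (1 + 1) * (q * b) /\ (1 + 1) * A = 0.
  split.
    apply/eqP; rewrite -subr_eq0; apply/eqP.
    have -> : (1 + 1) * r - (1 + 1) * (q * b) = (r + A - q * b) + (r - A - q * b) by ring.
    by rewrite h1 hN1 addr0.
  have -> : (1 + 1) * A = (r + A - q * b) - (r - A - q * b) by ring.
  by rewrite h1 hN1 subr0.
have large (t : K) : t != 0 -> t != 1 -> t != -1 -> [/\ q = 0, r = 0 & b = p ^+ 2].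
  move=> t0 t1 tN1; have ht := h t t0; have [c2|c2] := eqVneq (1 + 1 : K) 0.
    have ht1 : r + (t + 1) * A - (t + 1) ^+ 2 * (q * b) = 0.
      by apply: h; rewrite addr_eq0.
    have qbA : A = q * b.
      have e : A - q * b = (r + (t + 1) * A - (t + 1) ^+ 2 * (q * b))
          - (r + t * A - t ^+ 2 * (q * b)) + (1 + 1) * (t * (q * b)) by ring.
      by apply/eqP; rewrite -subr_eq0 e ht1 ht c2 mul0r subrr addr0.
    have r0 : r = 0.
      have -> : r = (r + A - q * b) - (A - q * b) by ring.
      by rewrite h1 qbA !subrr.
    have qb0 : q * b = 0.
      have : t * (1 - t) * (q * b) = 0.
        by rewrite -[RHS]ht r0 qbA; ring.
      by move/eqP; rewrite -mulrA mulf_eq0 (negbTE t0) mulf_eq0 subr_eq0 eq_sym (negbTE t1) => /eqP.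
    by apply: conclude => //; rewrite qbA.
  have [e1 /eqP] := even_odd; rewrite mulf_eq0 (negbTE c2) => /eqP A0.
  have rqb : r = q * b by exact: (mulfI c2).
  have qb0 : q * b = 0.
    have : (1 - t) * (1 + t) * (q * b) = 0 by rewrite -[RHS]ht A0 rqb; ring.
    move/eqP; rewrite mulf_eq0 mulf_eq0 subr_eq0 [1 == t]eq_sym (negbTE t1) /=.
    by rewrite [1 + t]addrC addr_eq0 (negbTE tN1) => /eqP.
  by apply: conclude; rewrite ?rqb.
have [/and3P[/eqP ? /eqP ? /eqP ?] //|nC] := boolP [&& q == 0, r == 0 & b == p ^+ 2].
have small (t : K) : [|| t == 0, t == 1 | t == -1].
  apply: contraNT nC; rewrite !negb_or => /and3P[t0 t1 tN1].
  by have [-> -> ->] := large t t0 t1 tN1; rewrite !eqxx.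
have p2 : p ^+ 2 = 1.
  by have := small p; rewrite (negbTE p0) /= => /orP[] /eqP ->; rewrite ?sqrrN expr1n.
have [c2|c2] := eqVneq (1 + 1 : K) 0.
  have N1 : -1 = 1 :> K by apply/eqP; rewrite eq_sym -addr_eq0 c2.
  have s01 (t : K) : t = 0 \/ t = 1.
    by have := small t; rewrite N1 orbb => /orP[] /eqP ->; [left|right].
  have b1 : b = 1 by case: (s01 b) => // e; rewrite e eqxx in b0.
  move: h1; rewrite /A p2 b1 subrr add0r mulr1.
  have absurd (x : K) : x = 1 -> x = 0 -> False.
    by move=> -> /eqP; rewrite oner_eq0.
  case: (s01 q) => ->; case: (s01 r) => -> // e; exfalso.
  - by apply: absurd e; ring.
  - by move: e; rewrite mul1r !add0r N1 => /eqP; rewrite oner_eq0.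
  by apply: absurd e; ring.
have [e1 /eqP] := even_odd; rewrite mulf_eq0 (negbTE c2) => /eqP A0.
have rqb : r = q * b by exact: (mulfI c2).
move: A0; rewrite /A rqb p2 => A0.
have := small b; rewrite (negbTE b0) /= => /orP[] /eqP b1; move: A0; rewrite b1.
  rewrite subrr add0r mulr1 => /eqP; rewrite mulf_eq0 orbb => /eqP ->.
  by split.
rewrite opprK => A0; exfalso; have := small q => /or3P[] /eqP q1; move: A0; rewrite q1.
- by rewrite !mul0r addr0 => /eqP; rewrite (negbTE c2).
- by rewrite !mul1r addrK => /eqP; rewrite oner_eq0.
by rewrite mulrNN !mulr1 addrK => /eqP; rewrite oner_eq0.
Qed.

(** The matrix with rows [x y] and [z t]. *)
Definition mx2 (x y z t : K) : 'M[K]_2 :=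
  \matrix_(i, j) if i == ord0 then (if j == ord0 then x else y)
                 else (if j == ord0 then z else t).

Lemma mul2E (A B : 'M[K]_2) i j :
  (A *m B) i j = A i ord0 * B ord0 j + A i ord_max * B ord_max j.
Proof.
rewrite mxE !big_ord_recl big_ord0 addr0; congr (_ + A _ _ * B _ _); exact: val_inj.
Qed.

(** For a nilpotent [N] and a vector [v] with [N v] non-zero, take [N v] and [v] as
    the columns of the conjugating matrix. *)
Lemma sl2_nilpotent_conj (a b c : K) : sl2 a b c != 0 -> \det (sl2 a b c) = 0 ->
  exists2 P : 'M[K]_2, P \in unitmx & sl2 a b c *m P = P *m sl2 0 1 0.
Proof.
move=> nz; rewrite det_sl2 => /eqP; rewrite oppr_eq0 => /eqP d0.
have [c0|c0] := eqVneq c 0.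
  have a0 : a = 0 by move: d0; rewrite c0 mulr0 addr0 => /eqP; rewrite sqrf_eq0 => /eqP.
  have b0 : b != 0.
    by apply: contraNneq nz => b0; rewrite a0 b0 c0; apply/eqP; apply: mx2P; rewrite !mxE //= oppr0.
  exists (mx2 b 0 0 1); first by rewrite unitmxE unitfE det2E !mxE /= mulr1 mulr0 subr0.
  by apply: mx2P; rewrite !mul2E !mxE /= ?a0 ?c0; ring.
exists (mx2 a 1 c 0); first by rewrite unitmxE unitfE det2E !mxE /= mulr0 mul1r sub0r oppr_eq0.
apply: mx2P; rewrite !mul2E !mxE /=; try ring.
by rewrite !mulr0 addr0 -d0; ring.
Qed.

(** The inverse [g] of [F] preserves nilpotency on the trace-zero matrices. *)
Lemma sl_preserver_standard2 (F : {linear 'M[K]_2 -> 'M[K]_2}) :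
  sl_preserver F -> standard_on_sl F.
Proof.
move=> [Ftr F_inj F_unit]; pose g := ((linfun F)^-1)%VF.
have Fg M : F (g M) = M.
  have ker0 : lker (linfun F) == 0%VS.
    by apply/lker0P => x y; rewrite !lfunE => /F_inj.
  by rewrite -[RHS](lker0_lfunVK ker0) lfunE.
have gF M : g (F M) = M by apply: F_inj; rewrite Fg.
have g_inj : injective g by exact: can_inj Fg.
have trg M : \tr (g M) = \tr M by rewrite -Ftr Fg.
have detg M : \tr M = 0 -> \det M = 0 -> \det (g M) = 0.
  move=> trM dM; apply/eqP; apply: contraT => nz.
  have /F_unit/(_ _) : \tr (g M) = 0 by rewrite trg.
  by rewrite Fg !unitmxE !unitfE dM eqxx => /(_ nz).
have tr0 a b c : \tr (sl2 a b c) = 0 by rewrite tr2E !mxE /= subrr.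
have sl20 : sl2 0 0 0 = 0 by apply: mx2P; rewrite !mxE //= oppr0.
have sl2_inj a b c a' b' c' : sl2 a b c = sl2 a' b' c' -> [/\ a = a', b = b' & c = c'].
  move=> /matrixP e; split.
  - by have := e ord0 ord0; rewrite !mxE.
  - by have := e ord0 ord_max; rewrite !mxE.
  by have := e ord_max ord0; rewrite !mxE.
(* Conjugate so that the images of the elementary nilpotent matrices are
   proportional to themselves. *)
have [P uP gP] : exists2 P : 'M[K]_2, P \in unitmx & g (sl2 0 1 0) *m P = P *m sl2 0 1 0.
  rewrite [g _]sl2E ?trg //; apply: sl2_nilpotent_conj; rewrite -sl2E ?trg //.
    apply/eqP => e; have /g_inj : g (sl2 0 1 0) = g 0 by rewrite e linear0.
    by rewrite -sl20 => /sl2_inj[_ /eqP]; rewrite oner_eq0.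
  by apply: detg => //; rewrite det_sl2; ring.
pose g1 M := invmx P *m g M *m P.
have g1L k A B : g1 (k *: A + B) = k *: g1 A + g1 B.
  by rewrite /g1 linearP mulmxDr mulmxDl -scalemxAr -scalemxAl.
have g1_inj : injective g1.
  move=> A B /(congr1 (mulmx^~ (invmx P))); rewrite /g1 !mulmxK //.
  by move=> /(congr1 (mulmx P)); rewrite !mulKVmx // => /g_inj.
have trg1 M : \tr (g1 M) = \tr M by rewrite /g1 mxtrace_mulC mulmxA mulmxV // mul1mx.
have detg1 M : \tr M = 0 -> \det M = 0 -> \det (g1 M) = 0.
  by move=> trM dM; rewrite /g1 !det_mulmx detg // mulr0 mul0r.
have g1E : g1 (sl2 0 1 0) = sl2 0 1 0 by rewrite /g1 -mulmxA gP mulKmx.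
have [x [y [z gE]]] : exists x y z, g1 (sl2 0 0 1) = sl2 x y z.
  by do 3 eexists; apply: sl2E; rewrite trg1.
have d0 : x ^+ 2 + y * z = 0.
  apply/eqP; rewrite -oppr_eq0 -det_sl2 -gE detg1 //.
  by rewrite det_sl2; ring.
have z0 : z != 0.
  apply/eqP => z0; have x0 : x = 0.
    by move: d0; rewrite z0 mulr0 addr0 => /eqP; rewrite sqrf_eq0 => /eqP.
  have /g1_inj : g1 (sl2 0 0 1) = g1 (y *: sl2 0 1 0 + sl2 0 0 0).
    rewrite g1L g1E gE x0 z0 sl20 /g1 linear0 mulmx0 mul0mx addr0.
    by apply: mx2P; rewrite !mxE /= ?mulr0 ?mulr1 ?oppr0 ?mulrN ?mulr0 ?oppr0.
  by rewrite sl2_lin => /sl2_inj[_ _ /eqP]; rewrite mulr0 addr0 oner_eq0.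
pose U := mx2 1 (x / z) 0 1.
have uU : U \in unitmx.
  by rewrite unitmxE unitfE det2E !mxE /= mulr1 mulr0 subr0 oner_eq0.
have UE : sl2 0 1 0 *m U = U *m sl2 0 1 0.
  by apply: mx2P; rewrite !mul2E !mxE /=; ring.
have UF : sl2 x y z *m U = U *m sl2 0 0 z.
  have xz : x / z * z = x by rewrite divfK.
  apply: mx2P; rewrite !mul2E !mxE /=.
  - by rewrite xz; ring.
  - have e : x * (x / z) + y = 0.
      apply: (mulfI z0); rewrite mulr0 -d0.
      have -> : z * (x * (x / z) + y) = x * (x / z * z) + y * z by ring.
      by rewrite xz; ring.
    by rewrite mulr1 e; ring.
  - by ring.
  by rewrite [z * _]mulrC xz; ring.
pose Q := P *m U; have uQ : Q \in unitmx by rewrite unitmx_mul uP uU.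
have Q1 : invmx Q = invmx U *m invmx P.
  by rewrite -[RHS](mulmxK uQ) /Q mulmxA mulmxKV // mulVmx // mul1mx.
pose g2 M := invmx Q *m g M *m Q.
have g2E M : g2 M = invmx U *m g1 M *m U by rewrite /g2 /g1 Q1 /Q !mulmxA.
have g2L k A B : g2 (k *: A + B) = k *: g2 A + g2 B.
  by rewrite !g2E g1L mulmxDr mulmxDl -scalemxAr -scalemxAl.
have g2_inj : injective g2.
  move=> A B; rewrite /g2 => /(congr1 (mulmx^~ (invmx Q))); rewrite !mulmxK //.
  by move=> /(congr1 (mulmx Q)); rewrite !mulKVmx // => /g_inj.
have detg2 M : \tr M = 0 -> \det M = 0 -> \det (g2 M) = 0.
  by move=> trM dM; rewrite /g2 !det_mulmx detg // mulr0 mul0r.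
have g2_0 : g2 (sl2 0 0 0) = sl2 0 0 0.
  by rewrite sl20 /g2 linear0 mulmx0 mul0mx.
have eE : g2 (sl2 0 1 0) = sl2 0 1 0 by rewrite g2E g1E -mulmxA UE mulKmx.
have eF : g2 (sl2 0 0 1) = sl2 0 0 z by rewrite g2E gE -mulmxA UF mulKmx.
have [p [q [r eH]]] : exists p q r, g2 (sl2 1 0 0) = sl2 p q r.
  do 3 eexists; apply: sl2E.
  by rewrite /g2 mxtrace_mulC mulmxA mulmxV // mul1mx trg.
have g2_sl2 a b c : g2 (sl2 a b c) = sl2 (a * p) (a * q + b) (a * r + c * z).
  have -> : sl2 a b c = a *: sl2 1 0 0 + (b *: sl2 0 1 0 + (c *: sl2 0 0 1 + sl2 0 0 0)).
    by rewrite !sl2_lin; congr sl2; ring.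
  rewrite !g2L eE eF eH g2_0 !sl2_lin; congr sl2; ring.
have p0 : p != 0.
  apply/eqP => p0; have /g2_inj : g2 (sl2 1 0 0) = g2 (sl2 0 q (r / z)).
    by rewrite !g2_sl2 p0; congr sl2; rewrite ?divfK //; ring.
  by move/sl2_inj => -[/eqP]; rewrite oner_eq0.
(* The matrices with entries [t], [1], [- t ^+ 2] and [- t] are nilpotent, so their
   images have determinant zero. *)
have [q0 r0 zp] : [/\ q = 0, r = 0 & z = p ^+ 2].
  apply: quadratic_conditions => // t t0; apply: (mulfI t0); rewrite mulr0.
  have := detg2 (sl2 t 1 (- t ^+ 2)) (tr0 _ _ _).
  rewrite g2_sl2 !det_sl2 => /(_ _)/eqP; rewrite oppr_eq0 => /(_ _)/eqP <-; last by ring.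
  by ring.
pose D := mx2 1 0 0 p; have uD : D \in unitmx.
  by rewrite unitmxE unitfE det2E !mxE /= mul1r mulr0 subr0.
pose R := Q *m D; have uR : R \in unitmx by rewrite unitmx_mul uQ uD.
have gR M : \tr M = 0 -> g M *m R = p *: (R *m M).
  move=> trM; have e : g2 M *m D = p *: (D *m M).
    rewrite [M]sl2E // g2_sl2 q0 r0 zp.
    by apply: mx2P; rewrite [RHS]mxE !mul2E !mxE /=; ring.
  rewrite /R -[in RHS]mulmxA scalemxAr -e /g2 !mulmxA.
  by rewrite mulmxV // mul1mx.
exists (invmx R), p^-1; split; rewrite ?unitmx_inv ?invr_eq0 //.
left=> M trM; have := gR (F M); rewrite Ftr gF => /(_ trM) MR.
by rewrite invmxK -mulmxA MR -scalemxAr mulKmx // scalerK.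
Qed.

End OrderTwo.

(** * The theorem *)

Lemma sl_preserver_standard1 (K : fieldType) (F : {linear 'M[K]_1 -> 'M[K]_1}) :
  standard_on_sl F.
Proof.
exists 1%:M, 1; split; rewrite ?unitmx1 ?oner_eq0 //; left=> M trM.
have -> : M = 0.
  apply/matrixP => i j; rewrite !ord1 [RHS]mxE -trM /mxtrace big_ord1 //.
by rewrite linear0 mulmx0 mul0mx scaler0.
Qed.

Lemma sl_preserver_is_standard (K : fieldType) (n : nat)
    (F : {linear 'M[K]_n.+1 -> 'M[K]_n.+1}) :
  sl_preserver F -> standard_on_sl F.
Proof.
case: n F => [|[|[|m]]] F slF.
- exact: sl_preserver_standard1.
- exact: sl_preserver_standard2.
- have [[e [e0 e1]]|no_e] := classic (exists e : K, e != 0 /\ e != 1).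
    by apply: sl_preserver_standard => // T; apply: good_space3_contains e0 e1.
  apply: sl3_two_elements slF => a.
  have [->|a0] := eqVneq a 0; first by left.
  have [->|a1] := eqVneq a 1; first by right.
  by case: no_e; exists a.
by apply: sl_preserver_standard => // T; exact: good_space_contains.
Qed.

(** A linear endomorphism of the trace-zero matrices is extended to all matrices. *)
Section Extension.

Variables (K : fieldType) (n : nat).
Variable f : {linear subvs_of (sl K n.+1) -> subvs_of (sl K n.+1)}.

Let E : 'M[K]_n.+1 := delta_mx 0 0.

(** The extension of [f] to all matrices that fixes a matrix of trace one. *)
Definition extend_sl (M : 'M[K]_n.+1) : 'M[K]_n.+1 :=
  vsval (f (vsproj (sl K n.+1) (M - \tr M *: E))) + \tr M *: E.

Fact extend_sl_is_linear : linear extend_sl.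
Proof.
move=> a x y; rewrite /extend_sl.
have -> : a *: x + y - \tr (a *: x + y) *: E =
    a *: (x - \tr x *: E) + (y - \tr y *: E).
  by rewrite linearP /= scalerDl scalerBr scalerA opprD addrACA.
rewrite !linearP /= scalerDl scalerDr scalerA addrACA.
by rewrite -scalerA.
Qed.
HB.instance Definition _ := GRing.isLinear.Build K 'M[K]_n.+1 'M[K]_n.+1 _
  extend_sl extend_sl_is_linear.

Lemma extend_slE (M : subvs_of (sl K n.+1)) : extend_sl (vsval M) = vsval (f M).
Proof.
have /eqP trM : \tr (vsval M) == 0 by rewrite -mem_sl subvsP.
by rewrite /extend_sl trM scale0r subr0 addr0 vsvalK.
Qed.

Lemma sl_preserver_extend : bijective f ->
  (forall M, vsval M \in unitmx -> vsval (f M) \in unitmx) ->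
  sl_preserver extend_sl.
Proof.
move=> f_bij f_unit.
have trE : \tr E = 1.
  rewrite /mxtrace (bigD1 0) //= big1 ?addr0 ?mxE ?eqxx // => i i0.
  by rewrite mxE (negbTE i0).
have tr_f M : \tr (vsval (f M)) = 0 by apply/eqP; rewrite -mem_sl subvsP.
have trF M : \tr (extend_sl M) = \tr M.
  by rewrite /extend_sl linearD /= tr_f add0r linearZ /= trE mulr1.
have in_sl M : M - \tr M *: E \in sl K n.+1.
  by rewrite mem_sl linearB linearZ /= trE mulr1 subrr.
split=> // [M N eMN|M trM uM].
  have trMN : \tr M = \tr N by rewrite -trF eMN trF.
  have hM : M - \tr N *: E \in sl K n.+1 by rewrite -trMN in_sl.
  have {eMN} : vsval (f (vsproj (sl K n.+1) (M - \tr M *: E))) + \tr M *: E =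
    vsval (f (vsproj (sl K n.+1) (N - \tr N *: E))) + \tr N *: E := eMN.
  rewrite trMN => /addIr/val_inj/(bij_inj f_bij)/(congr1 vsval).
  by rewrite (vsprojK hM) (vsprojK (in_sl N)) => /addIr.
have Msl : M \in sl K n.+1 by rewrite mem_sl trM.
by have := f_unit (vsproj (sl K n.+1) M); rewrite -extend_slE vsprojK //; apply.
Qed.

End Extension.

Theorem theorem27 (K : fieldType) (n : nat) (n_gt0 : (0 < n)%N)
    (f : {linear subvs_of (sl K n) -> subvs_of (sl K n)})
    (f_bij : bijective f)
    (f_unit : forall M : subvs_of (sl K n),
       vsval M \in unitmx -> vsval (f M) \in unitmx) :
  exists (P : 'M[K]_n) (lambda : K),
    [/\ P \in unitmx, lambda != 0 &
      (forall M : subvs_of (sl K n),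
         vsval (f M) = lambda *: (P *m vsval M *m invmx P))
      \/
      (forall M : subvs_of (sl K n),
         vsval (f M) = lambda *: (P *m (vsval M)^T *m invmx P))].
Proof.
case: n n_gt0 f f_bij f_unit => // n _ f f_bij f_unit.
have [P [lambda [uP l0 PE]]] :=
  sl_preserver_is_standard (sl_preserver_extend f_bij f_unit).
have tr0 (M : subvs_of (sl K n.+1)) : \tr (vsval M) = 0.
  by apply/eqP; rewrite -mem_sl subvsP.
exists P, lambda; split=> //.
by case: PE => PE; [left | right] => M;
  exact: etrans (esym (extend_slE f M)) (PE _ (tr0 M)).
Qed.
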